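(* Let $d\ge1$, $2<p<\infty$, $1<q<\infty$, $q'=\frac{q}{q-1}$. Let $\Phi$ be a regular function such that $\Phi(t)/t^{q'/2}\to0$ as $t\to0$. Then there exist a compact set $S\subset\mathbb{R}^d$ and a probability measure $\mu$ with $\operatorname{supp}\mu\subset S$, $\hat\mu\in L_{p,q}(\mathbb{R}^d)$ and $\mathcal{H}_{\frac{2d}{p},\Phi}(S)=0$.
   Context: A continuous non-decreasing function $g:\mathbb{R}_+\to\mathbb{R}_+$ is regular if $g(0)=0$ and for some fixed $c>1$, $g(x)\asymp g(cx)$ (two-sided bound with constants independent of $x$). With $\Delta_k=[2^{-k-1},2^{-k})$, $k\in\mathbb{Z}$, for $F\subset\mathbb{R}^d$, $\alpha>0$, $\delta>0$: $\mathcal{H}_{\alpha,\Phi}(F,\delta)=\inf\big\{\sum_k\Phi\big(\sum_{j:\,\operatorname{diam}B_j\in\Delta_k}(\operatorname{diam}B_j)^\alpha\big): F\subset\bigcup_jB_j,\ \operatorname{diam}B_j<\delta\big\}$ (countable covers) and $\mathcal{H}_{\alpha,\Phi}(F)=\lim_{\delta\to0}\mathcal{H}_{\alpha,\Phi}(F,\delta)$. Lorentz space: $\|f\|^q_{L_{p,q}}=q\int_0^\infty (m_f(t)t^p)^{q/p}\frac{dt}{t}$, with $m_f(t)$ the Lebesgue measure of $\{|f|\geqslant t\}$. *)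

(* Defs.v *)
From mathcomp Require Import all_boot all_order all_algebra.
From mathcomp Require Import all_classical all_reals all_analysis.
Import Order.TTheory GRing.Theory Num.Theory numFieldNormedType.Exports.

Set Implicit Arguments.
Unset Strict Implicit.
Unset Printing Implicit Defensive.

Local Open Scope ring_scope.
Local Open Scope classical_set_scope.

Section Defs.
Variable R : realType.
Variable d : nat.
Notation Rd := (d.-tuple R).

Definition dotp (x y : Rd) : R := \sum_(i < d) tnth x i * tnth y i.
Definition edist (x y : Rd) : R :=
  Num.sqrt (\sum_(i < d) (tnth x i - tnth y i) ^+ 2).

(* view of a point of R^d as a row vector (to use the topology of R^d) *)
Definition to_row (x : Rd) : 'rV[R]_d := \row_(i < d) tnth x i.

Definition cball (c : Rd) (r : R) : set Rd := [set y | edist c y <= r].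
Definition oball (c : Rd) (r : R) : set Rd := [set y | edist c y < r].

Definition diam (F : set Rd) : \bar R :=
  ereal_sup [set (edist x y)%:E | x in F & y in F].

Definition box (a b : Rd) : set Rd :=
  [set x | forall i : 'I_d, tnth a i <= tnth x i <= tnth b i].
Definition lebesgue_d (A : set Rd) : \bar R :=
  ereal_inf [set s | exists a b : nat -> Rd,
    [/\ (forall k (i : 'I_d), tnth (a k) i <= tnth (b k) i),
        A `<=` \bigcup_k box (a k) (b k) &
        s = (\sum_(0 <= k <oo) (\prod_(i < d) (tnth (b k) i - tnth (a k) i))%:E)%E]].

Definition fourier_re (mu : probability Rd R) (xi : Rd) : R :=
  \int[mu]_x cos (2 * pi * dotp x xi).
Definition fourier_im (mu : probability Rd R) (xi : Rd) : R :=
  - \int[mu]_x sin (2 * pi * dotp x xi).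
Definition fourier_abs (mu : probability Rd R) (xi : Rd) : R :=
  Num.sqrt (fourier_re mu xi ^+ 2 + fourier_im mu xi ^+ 2).

Definition distrib (f : Rd -> R) (t : R) : \bar R :=
  lebesgue_d [set xi | t <= `|f xi|].

Definition lorentz_normq (p q : R) (f : Rd -> R) : \bar R :=
  (q%:E * \int[lebesgue_measure]_(t in [set t : R | (0 < t)%R])
     (poweR (distrib f t * (powR t p)%R%:E) ((q / p)%R) * ((t^-1)%R)%:E))%E.
Definition in_Lorentz (p q : R) (f : Rd -> R) : Prop :=
  (lorentz_normq p q f < +oo)%E.

Definition msupport (mu : probability Rd R) : set Rd :=
  [set x | forall r : R, 0 < r -> (0 < mu (oball x r))%E].

Definition regular (g : R -> R) : Prop :=
  [/\ {within `[0%R, +oo[%classic, continuous g},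
      {in `[0, +oo[ &, {homo g : x y / x <= y}},
      (forall x, 0 <= x -> 0 <= g x),
      g 0 = 0 &
      exists2 c : R, 1 < c & exists2 K : R, 0 < K &
        forall x, 0 <= x -> g x <= K * g (c * x) /\ g (c * x) <= K * g x].

(* extension of Phi to [0, +oo] by monotone limit: Phi(+oo) = sup Phi *)
Definition ephi (Phi : R -> R) (x : \bar R) : \bar R :=
  match x with
  | r%:E => (Phi r)%:E
  | +oo%E => ereal_sup [set (Phi r)%:E | r in [set r : R | 0 <= r]]
  | -oo%E => 0%E
  end.

Definition in_Delta (k : int) (x : \bar R) : Prop :=
  ((2 ^ (- k - 1))%:E <= x < (2 ^ (- k))%:E)%E.

Definition cover_value (alpha : R) (Phi : R -> R) (c : nat -> Rd) (r : nat -> R)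
  : \bar R :=
  (\esum_(k in [set: int])
     ephi Phi (\esum_(j in [set j | in_Delta k (diam (cball (c j) (r j)))])
                 poweR (diam (cball (c j) (r j))) alpha))%E.

Definition HPhi_delta (alpha : R) (Phi : R -> R) (F : set Rd) (delta : R)
  : \bar R :=
  ereal_inf [set s | exists (c : nat -> Rd) (r : nat -> R),
    [/\ (forall j, 0 < r j),
        (forall j, (diam (cball (c j) (r j)) < delta%:E)%E),
        F `<=` \bigcup_j cball (c j) (r j) &
        s = cover_value alpha Phi c r]].

Definition HPhi (alpha : R) (Phi : R -> R) (F : set Rd) : \bar R :=
  lim (HPhi_delta alpha Phi F delta @[delta --> 0^'+]).

End Defs.

(* Main.v *)
(* With [alpha = 2d/p], one stage replaces the current mixture of cubes by one that
   lives at [n] widely separated small scales: the [k]-th fraction [1/n] of its mass is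
   put on random subcubes of side [r_k], about [t r_k^(-alpha)] of them.  Choosing the
   subcubes independently inside each old cube keeps the expected measure equal to the
   old one, so the change of the Fourier transform is a sub-Gaussian sum of size
   [(1/n) t^(-1/2) r_k^(d/p)] up to the frequency [1/r_k], where it starts to decay.  In
   [L_{p,q}] the [n] scales contribute [n ((1/n) t^(-1/2))^q], a negative power of
   [n t^(q'/2)], while covering the support costs [n Phi(t) = o(n t^(q'/2))].  So both
   can be made as small as desired, and summably so over the stages.  The measures
   converge because the cubes are nested: the limit is the image of Lebesgue measure on
   [[0, 1[] under the limit of the maps that send the [i]-th of [K] equal intervals to
   the centre of the [i]-th cube. *)

(* One choice of subcubes has to serve every level, a whole range of exponents and all frequencies.
   It comes from averaging a single weighted sum of exponential moments over a fine grid of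
   frequencies. The weight is the square of the decay of [psi], which is summable; this is how the
   exponent 2, and with it [2 < p], enters. The increment of step [j] then has amplitude
   [A j = c j * r j ^ (d / p)] on a set of measure about [r j ^- d = (c j / A j) ^ p]. The sides may
   shrink as fast as desired, so the amplitudes can be made lacunary, and the [q]-th power of the
   quasi-norm is then controlled by the sum of the [c j ^ q], whatever the order of [p] and [q].
   Level sets are handled only through monotonicity and countable subadditivity, [lebesgue_d] being
   an outer measure. All cubes of a step have the same weight and the same number of children.
   Parents and fractions are thus given by integer division of the index, and a cube lies in the
   same fraction as its ancestors within a block of [n] steps: each point of the limit set passes
   through an active cube in every block. *)
From HB Require Import structures.
From mathcomp Require Import all_boot all_order all_algebra.
From mathcomp Require Import all_classical all_reals all_analysis.
From mathcomp Require Import measurable_realfun ring lra zify.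
From mathcomp Require Import complex.
Require Import Defs.
Set Implicit Arguments.
Unset Strict Implicit.
Unset Printing Implicit Defensive.
Import Order.TTheory GRing.Theory Num.Theory numFieldNormedType.Exports.
Local Open Scope ring_scope.
Local Open Scope classical_set_scope.

(** * Trigonometric identities *)

Section trig.
Context {R : realType}.
Implicit Types (x y w t : R).

Lemma sin_lip x y : `|sin x - sin y| <= `|x - y|.
Proof.
wlog lexy : x y / x <= y.
  move=> H; have [/H//|/ltW/H] := leP x y.
  by rewrite distrC [in leRHS]distrC.
have [|c _] := @MVT_segment R sin cos x y lexy (fun z _ => is_derive_sin z).
  exact/continuous_subspaceT/continuous_sin.
rewrite distrC [in leRHS]distrC => ->; rewrite normrM ler_piMl// cos_max//.
Qed.

Lemma cos_lip x y : `|cos x - cos y| <= `|x - y|.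
Proof.
rewrite -!sinDpihalf (le_trans (sin_lip _ _))//.
by rewrite (_ : x + pi / 2 - (y + pi / 2) = x - y)//; ring.
Qed.

Definition sinc x : R := if x == 0 then 1 else sin x / x.

Lemma sinc_le1 x : `|sinc x| <= 1.
Proof.
rewrite /sinc; case: eqVneq => [_|x0]; first by rewrite normr1.
rewrite normrM normfV ler_pdivrMr ?normr_gt0// mul1r.
by have := sin_lip x 0; rewrite sin0 !subr0.
Qed.

Lemma sinc_decay x : `|sinc x| <= 2 / (1 + `|x|).
Proof.
rewrite ler_pdivlMr ?ltr_wpDr// mulrDr mulr1 -[2]/(1 + 1) lerD ?sinc_le1//.
rewrite /sinc; case: eqVneq => [->|x0]; first by rewrite normr0 mulr0.
by rewrite -normrM divfK// sin_max.
Qed.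

Lemma sinc_near1 x : `|1 - sinc x| <= `|x|.
Proof.
wlog x0 : x / 0 <= x.
  move=> H; have [/H//|/ltW x0] := leP 0 x.
  have := H (- x); rewrite oppr_ge0 normrN => /(_ x0).
  by rewrite /sinc oppr_eq0 sinN invrN mulrNN.
have [|c] := @MVT_segment R sin cos 0 x x0 (fun z _ => is_derive_sin z).
  exact/continuous_subspaceT/continuous_sin.
rewrite sin0 !subr0 in_itv/= => /andP[c0 cx] e.
rewrite /sinc; case: eqVneq => [->|xn0]; first by rewrite subrr normr0.
rewrite e mulfK// -{1}(cos0 R) (le_trans (cos_lip _ _))//.
by rewrite sub0r normrN !ger0_norm.
Qed.

Definition cis t : R[i] := (cos t +i* sin t)%C.

Lemma cisD x y : cis (x + y) = cis x * cis y.
Proof. by rewrite /cis cosD sinD; simpc; rewrite [sin x * cos y + _]addrC. Qed.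

Lemma cis0 : cis 0 = 1.
Proof. by rewrite /cis cos0 sin0. Qed.

Lemma cis_sum (I : finType) (F : I -> R) : cis (\sum_i F i) = \prod_i cis (F i).
Proof. exact: (big_morph cis cisD cis0). Qed.

Lemma Re_sum (I : finType) (F : I -> R[i]) :
  complex.Re (\sum_i F i) = \sum_i complex.Re (F i).
Proof. by apply: (big_morph (@complex.Re R)) => // -[a b] [c e]. Qed.

Lemma Im_sum (I : finType) (F : I -> R[i]) :
  complex.Im (\sum_i F i) = \sum_i complex.Im (F i).
Proof. by apply: (big_morph (@complex.Im R)) => // -[a b] [c e]. Qed.

(* The measure identity behind it: the uniform measure on an interval is the
   mean of the uniform measures on its [D] equal subintervals. *)
Lemma mean_cis (D : nat) w : (0 < D)%N ->
  \sum_(a < D) cis (w * (2 * a%:R + 1 - D%:R)) * (sinc w)%:C%C =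
  (D%:R * sinc (D%:R * w))%:C%C.
Proof.
move=> D0; rewrite /sinc mulf_eq0 pnatr_eq0 (gtn_eqF D0)/=.
case: eqVneq => [->|w0].
  under eq_bigr do rewrite mul0r cis0 mul1r.
  by rewrite sumr_const card_ord mulr1 rmorph_nat.
suff H : \sum_(a < D) cis (w * (2 * a%:R + 1 - D%:R)) * (sin w)%:C%C =
   (sin (D%:R * w))%:C%C.
  under eq_bigr do rewrite rmorphM /= mulrA.
  rewrite -mulr_suml H -rmorphM; congr (_%:C%C); field.
  by rewrite w0 pnatr_eq0 -lt0n.
(* Multiplied by [sin w], the sum telescopes: each term becomes half a difference of values of [sin]
   or [cos] at points [2 * w] apart. *)
have step a b : 2 * cos a * sin b = sin (a + b) - sin (a - b) :> R.
  by rewrite sinD sinB; ring.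
have step' a b : 2 * sin a * sin b = cos (a - b) - cos (a + b) :> R.
  by rewrite !cosD cosN sinN; ring.
have tele (f : nat -> R) n : \sum_(i < n) (f i.+1 - f i) = f n - f 0%N.
  by rewrite -(big_mkord xpredT (fun i => f i.+1 - f i)) telescope_sumr.
apply/eqP; rewrite eq_complex /=; apply/andP; split; apply/eqP.
  rewrite Re_sum.
  pose f (k : nat) : R := sin (w * (2 * k%:R - D%:R)) / 2.
  rewrite (eq_bigr (fun a : 'I_D => f a.+1 - f a)).
    rewrite tele /f.
    have -> : w * (2 * D%:R - D%:R) = D%:R * w by ring.
    have -> : w * (2 * 0%:R - D%:R) = - (D%:R * w) by ring.
    by rewrite sinN; field.
  move=> a _ /=; rewrite /f; simpc => /=.
  set u := w * (2 * a%:R + 1 - D%:R).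
  have -> : w * (2 * a.+1%:R - D%:R) = u + w by rewrite /u -natr1; ring.
  have -> : w * (2 * a%:R - D%:R) = u - w by rewrite /u; ring.
  by rewrite -mulrBl -step; field.
rewrite Im_sum.
pose f (k : nat) : R := - cos (w * (2 * k%:R - D%:R)) / 2.
rewrite (eq_bigr (fun a : 'I_D => f a.+1 - f a)).
  rewrite tele /f.
  have -> : w * (2 * D%:R - D%:R) = D%:R * w by ring.
  have -> : w * (2 * 0%:R - D%:R) = - (D%:R * w) by ring.
  by rewrite cosN subrr.
move=> a _ /=; rewrite /f; simpc => /=.
set u := w * (2 * a%:R + 1 - D%:R).
have -> : w * (2 * a.+1%:R - D%:R) = u + w by rewrite /u -natr1; ring.
have -> : w * (2 * a%:R - D%:R) = u - w by rewrite /u; ring.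
by rewrite addrC -mulrBl -step'; field.
Qed.

(** Expanding the product over the coordinates of the one-dimensional identities gives the sum over
    [g]; the phase [t] is brought in by multiplying with [cis t] before taking real parts. *)
Lemma mean_cos_grid (d D : nat) (w : 'I_d -> R) t : (0 < D)%N ->
  \sum_(g : {ffun 'I_d -> 'I_D})
    cos (t + \sum_a w a * (2 * (g a)%:R + 1 - D%:R)) * \prod_a sinc (w a) =
  (D ^ d)%:R * (cos t * \prod_a sinc (D%:R * w a)).
Proof.
move=> D0.
pose F (a : 'I_d) (j : 'I_D) :=
  cis (w a * (2 * j%:R + 1 - D%:R)) * (sinc (w a))%:C%C.
have : \prod_a \sum_j F a j = \sum_(g : {ffun 'I_d -> 'I_D}) \prod_a F a (g a).
  exact: bigA_distr_bigA.
under eq_bigr do rewrite mean_cis//.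
under [RHS]eq_bigr do rewrite big_split /= -cis_sum -rmorph_prod.
rewrite -rmorph_prod big_split /= prodr_const card_ord.
move=> /(congr1 (fun z => complex.Re (cis t * z))).
rewrite mulr_sumr Re_sum.
under [X in _ = X -> _]eq_bigr => g _.
  rewrite mulrA -cisD /cis; simpc => /=.
  over.
move=> <-.
by rewrite /cis; simpc => /=; rewrite natrX; ring.
Qed.

End trig.

(** * Sub-Gaussian averages *)

Section subgaussian.
Context {R : realType}.

(** From [1 - x <= expR (- x)] follows [expR x <= 1 / (1 - x)], and this is below the quadratic
    because [x ^ 2 * (1 - 2 * x) >= 0]. *)
Lemma expR_quad (x : R) : x <= 1 / 2 -> expR x <= 1 + x + 2 * x ^+ 2.
Proof.
move=> x2; have x1 : 0 < 1 - x by lra.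
rewrite -[x in expR x]opprK expRN (@le_trans _ _ (1 - x)^-1)//.
  by rewrite lef_pV2 ?posrE ?expR_gt0// expR_ge1Dx.
rewrite -[_^-1]mul1r ler_pdivrMr// -subr_ge0.
have -> : (1 + x + 2 * x ^+ 2) * (1 - x) - 1 = x ^+ 2 * (1 - 2 * x) by ring.
by rewrite mulr_ge0 ?sqr_ge0//; lra.
Qed.

(* The sum over all choice functions [f] of a product over [i] factorizes, so each
   factor is bounded with [expR_quad], whose linear term has zero mean. *)
Lemma subgauss (I G : finType) (E : {set I}) (X : I -> G -> R) :
  (0 < #|E|)%N -> (forall i g, `|X i g| <= 2) ->
  (forall i, \sum_g X i g = 0) ->
  \sum_(f : {ffun I -> G})
     expR ((\sum_(i in E) X i (f i)) / (4 * Num.sqrt #|E|%:R))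
  <= 2 * #|{ffun I -> G}|%:R.
Proof.
move=> E0 X2 Xm; set s := Num.sqrt _.
have s2 : s ^+ 2 = #|E|%:R by rewrite sqr_sqrtr.
have s1 : 1 <= s by rewrite -sqrtr1 ler_wsqrtr// ler1n.
have s0 : 0 < s by lra.
(* Two things are arranged at once: [l * |X i g| <= 1 / 2], as [expR_quad] requires, and
   [#|E| * 8 * l ^ 2 = 1 / 2], so that the product of the factors is [expR (1 / 2) <= 2]. *)
pose l := (4 * s)^-1; have l0 : 0 < l by rewrite invr_gt0 mulr_gt0.
have l4 : l <= 1 / 4.
  by rewrite /l invfM mul1r ler_piMr// invf_le1.
pose F i g := if i \in E then expR (l * X i g) else 1.
rewrite (eq_bigr (fun f : {ffun I -> G} => \prod_i F i (f i))); last first.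
  move=> f _; rewrite mulrC -/l mulr_sumr expR_sum big_mkcond; apply: eq_bigr => i _.
  by rewrite /F; case: ifP.
have <- : \prod_i \sum_g F i g = \sum_(f : {ffun I -> G}) \prod_i F i (f i).
  exact: bigA_distr_bigA.
apply: (@le_trans _ _ (\prod_i (#|G|%:R * (if i \in E then expR (8 * l ^+ 2) else 1)))).
  apply: ler_prod => i _; apply/andP; split.
    by apply: sumr_ge0 => g _; rewrite /F; case: ifP => // _; exact: expR_ge0.
  rewrite /F; case: ifP => _; last by rewrite sumr_const mulr1.
  apply: (@le_trans _ _ (\sum_g (1 + 8 * l ^+ 2 + l * X i g))).
    apply: ler_sum => g _; have := X2 i g; rewrite ler_norml => /andP[x1 x2].
    apply: le_trans (expR_quad _) _; first by nra.
    rewrite [leRHS]addrAC lerD2l exprMn.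
    have : X i g ^+ 2 <= 4 by nra.
    by have := sqr_ge0 l; nra.
  rewrite big_split /= -mulr_sumr Xm mulr0 addr0 sumr_const.
  by rewrite -[leLHS]mulr_natl ler_wpM2l//; exact: expR_ge1Dx.
rewrite big_split/= prodr_const -big_mkcond/= prodr_const -expRM_natl.
have -> : #|E|%:R * (8 * l ^+ 2) = 1 / 2 :> R.
  by rewrite /l -s2 exprVn; field; rewrite gt_eqF.
rewrite card_ffun natrX mulrC ler_wpM2r ?exprn_ge0//.
by apply: le_trans (expR_quad _) _ => //; lra.
Qed.

(** Twice [cosh (z / 4)]. It controls both signs of [z], and its two terms are averaged by
    [subgauss] applied to [X] and to [- X]. *)
Definition expch (z : R) := expR (z / 4) + expR (- (z / 4)).

Lemma subgauss_expch (I G : finType) (E : {set I}) (X : I -> G -> R) :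
  (0 < #|E|)%N -> (forall i g, `|X i g| <= 2) ->
  (forall i, \sum_g X i g = 0) ->
  \sum_(f : {ffun I -> G})
     expch ((\sum_(i in E) X i (f i)) / Num.sqrt #|E|%:R)
  <= 4 * #|{ffun I -> G}|%:R.
Proof.
move=> E0 X2 Xm.
have s0 : Num.sqrt #|E|%:R != 0 :> R by rewrite gt_eqF// sqrtr_gt0 ltr0n.
have -> : 4 * #|{ffun I -> G}|%:R = 2 * #|{ffun I -> G}|%:R + 2 * #|{ffun I -> G}|%:R :> R.
  by ring.
rewrite big_split/= lerD//.
  apply: le_trans (subgauss E0 X2 Xm); rewrite le_eqVlt; apply/orP; left.
  by apply/eqP; apply: eq_bigr => f _; congr expR; field.
apply: le_trans (@subgauss I G E (fun i g => - X i g) E0 _ _).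
- rewrite le_eqVlt; apply/orP; left; apply/eqP; apply: eq_bigr => f _.
  by congr expR; rewrite sumrN; field.
- by move=> i g; rewrite normrN.
- by move=> i; rewrite sumrN Xm oppr0.
Qed.

(** The inequality [(1 + y / m) ^ m <= expR y] for [y = |z| / 4] turns an exponential moment into an
    [m]-th moment with a constant that depends on [m] alone. *)
Lemma expch_ge (m : nat) (z : R) : (0 < m)%N ->
  (2 + `|z|) ^+ m <= (8 * m%:R) ^+ m * expch z.
Proof.
move=> m0; have mR : 1 <= m%:R :> R by rewrite ler1n.
have z0 := normr_ge0 z.
have : 2 + `|z| <= 8 * m%:R * (1 + `|z| / (4 * m%:R)).
  have -> : 8 * m%:R * (1 + `|z| / (4 * m%:R)) = 8 * m%:R + 2 * `|z|.
    by field; rewrite gt_eqF; lra.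
  by have := normr_ge0 z; lra.
move=> /(lerXn2r m) H; apply: le_trans (H _ _) _; rewrite ?nnegrE ?addr_ge0//.
rewrite exprMn ler_wpM2l ?exprn_ge0//.
apply: (@le_trans _ _ (expR (`|z| / (4 * m%:R)) ^+ m)).
  by rewrite lerXn2r ?nnegrE ?expR_ge0// ?expR_ge1Dx// addr_ge0// divr_ge0.
rewrite -expRM_natl.
have -> : m%:R * (`|z| / (4 * m%:R)) = `|z| / 4 by field; rewrite gt_eqF; lra.
rewrite /expch; have [z1|z1] := leP 0 z.
  by rewrite ger0_norm// lerDl expR_ge0.
by rewrite ltr0_norm// mulNr lerDr expR_ge0.
Qed.

(** Averaging gives a good [w] for each [L] separately, while one [w] has to serve arbitrarily large
    grids. If every [w] failed from some index on, then at the largest of these finitely many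
    indices all of them would fail, against the mean. *)
Lemma pigeonhole_bound (Om : finType) (W : nat -> Om -> R) (B : R) :
  (0 < #|Om|)%N ->
  (forall L, \sum_w W L w <= B * #|Om|%:R) ->
  exists w, forall L0, exists2 L, (L0 <= L)%N & W L w <= B.
Proof.
move=> Om0 H; apply: contrapT => nex.
have {nex} Hw w : exists L0, forall L, (L0 <= L)%N -> B < W L w.
  apply: contrapT => nL; apply: nex; exists w => L0.
  apply: contrapT => nL2; apply: nL; exists L0 => L lL.
  by rewrite ltNge; apply/negP => ?; apply: nL2; exists L.
have [f Hf] := choice Hw.
pose L := (\max_w f w)%N.
have := H L; rewrite leNgt => /negP; apply.
rewrite mulr_natr -sumr_const; case/card_gt0P: Om0 => w0 _.
apply: ltr_sum => [|w _]; first by apply/hasP; exists w0 => //; rewrite mem_index_enum.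
by apply: Hf; rewrite /L (leq_bigmax w).
Qed.

(** Comparison with the increments of [- (2 / h) / (1 + h * z)]; the factor 2 absorbs the shift from
    [u] to [u + h], since [h <= 1 <= u]. *)
Lemma sum_inv_sqr (h : R) (L : nat) : 0 < h <= 1 ->
  \sum_(z < L) (1 + h * z%:R) ^- 2 <= 2 / h.
Proof.
move=> /andP[h0 h1].
have hz z : 0 < 1 + h * z%:R by rewrite ltr_wpDr// mulr_ge0// ltW.
pose f (z : nat) := - (2 / h) * (1 + h * z%:R)^-1.
apply: (@le_trans _ _ (\sum_(z < L) (f z.+1 - f z))).
  apply: ler_sum => z _; rewrite /f -mulrBr mulNr -mulrN opprB.
  have := hz z; have := hz z.+1; rewrite -natr1 mulrDr mulr1 => u1 u0.
  set u := 1 + h * z%:R in u0 *.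
  have -> : 2 / h * (u^-1 - (1 + (h * z%:R + h))^-1) = u ^- 2 * (2 * u / (u + h)).
    by rewrite addrA -/u; field; rewrite !gt_eqF//; rewrite /u; lra.
  have uh : 0 < u + h by lra.
  rewrite ler_peMr ?invr_ge0 ?sqr_ge0// ler_pdivlMr// mul1r mulr_natl mulr2n lerD2l.
  have : 0 <= h * z%:R by rewrite mulr_ge0// ltW.
  rewrite /u; lra.
rewrite -(big_mkord xpredT (fun z => f z.+1 - f z)) telescope_sumr//.
rewrite /f mulr0 addr0 invr1 mulr1 opprK mulNr gerDr oppr_le0.
by rewrite mulr_ge0 ?divr_ge0 ?invr_ge0// ltW.
Qed.

End subgaussian.

(** * The outer measure [lebesgue_d] *)

Section lebesgue_d_theory.
Context {R : realType} {d : nat}.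
Notation Rd := (d.-tuple R).
Implicit Types A B : set Rd.

Let vol (a b : Rd) : \bar R := (\prod_(i < d) (tnth b i - tnth a i))%:E.

Let vol_ge0 (a b : Rd) : (forall i, tnth a i <= tnth b i) -> (0 <= vol a b)%E.
Proof. by move=> ab; rewrite lee_fin prodr_ge0// => i _; rewrite subr_ge0. Qed.

Lemma lebesgue_d_ge0 A : (0 <= lebesgue_d A)%E.
Proof.
apply: le_ereal_inf_tmp => _ [a [b [ab _ ->]]].
by apply: nneseries_ge0 => k _ _; exact: vol_ge0.
Qed.

Lemma le_lebesgue_d A B : A `<=` B -> (lebesgue_d A <= lebesgue_d B)%E.
Proof.
move=> AB; apply: le_ereal_inf => _ [a [b [ab Bab ->]]].
by exists a, b; split => //; exact: subset_trans Bab.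
Qed.

(** Each [A n] gets a cover that is optimal up to [e / 2 ^ n.+1], and the boxes of all covers are
    enumerated through a bijection of [nat] with the pairs. *)
Lemma lebesgue_d_sigma_subadditive (A : nat -> set Rd) :
  (lebesgue_d (\bigcup_n A n) <= \sum_(0 <= n <oo) lebesgue_d (A n))%E.
Proof.
have [[i ioo]|] := pselect (exists i, lebesgue_d (A i) = +oo%E).
  rewrite (eseries_pinfty _ _ ioo) ?leey// => n _.
  by rewrite -ltNye (lt_le_trans _ (lebesgue_d_ge0 _)).
rewrite -forallNE => Aoo.
suff add2e (e : {posnum R}) :
    (lebesgue_d (\bigcup_n A n) <= \sum_(0 <= i <oo) lebesgue_d (A i) + e%:num%:E)%E.
  by apply/lee_addgt0Pr => _/posnumP[].
rewrite (le_trans _ (epsilon_trick _ _ _))//; last first.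
  by move=> n; exact: lebesgue_d_ge0.
pose P n (ab : (nat -> Rd) * (nat -> Rd)) :=
  [/\ (forall k i, tnth (ab.1 k) i <= tnth (ab.2 k) i),
      A n `<=` \bigcup_k box (ab.1 k) (ab.2 k) &
      (\sum_(0 <= k <oo) vol (ab.1 k) (ab.2 k) <=
       lebesgue_d (A n) + (e%:num / (2 ^ n.+1)%:R)%:E)%E].
have [G PG] : {G : nat -> (nat -> Rd) * (nat -> Rd) & forall n, P n (G n)}.
  apply: (@choice _ _ P) => n; rewrite /P.
  have Afin : lebesgue_d (A n) \is a fin_num.
    by rewrite ge0_fin_numE ?lebesgue_d_ge0// ltey; apply/eqP/Aoo.
  have en1 : 0 < e%:num / (2 ^ n.+1)%:R :> R by [].
  have [x [a [b [ab Aab ->]]] xS] := lb_ereal_inf_adherent en1 Afin.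
  by exists (a, b); split => //; exact: ltW.
pose v (x : nat * nat) := vol ((G x.1).1 x.2) ((G x.1).2 x.2).
have v_ge0 x : (0 <= v x)%E by apply: vol_ge0; have [H _ _] := PG x.1; exact: H.
apply: (@le_trans _ _ (\esum_(x in [set: nat * nat]) v x)%E).
  apply: ereal_inf_lbound.
  have /card_esym/ppcard_eqP[f] := card_nat2.
  exists (fun k => (G (f k).1).1 (f k).2), (fun k => (G (f k).1).2 (f k).2); split.
  - by move=> k i; have [H _ _] := PG (f k).1; exact: H.
  - move=> x [n _ Anx]; have [_ /(_ _ Anx)[k _ Hk] _] := PG n.
    by exists (f^-1%FUN (n, k)) => //; rewrite invK ?inE.
  - rewrite (reindex_esum [set: nat] [set: nat * nat] f v)// nneseries_esumT//.
    by move=> k; exact: (v_ge0 (f k)).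
have -> : (\esum_(x in [set: nat * nat]) v x =
           \sum_(0 <= n <oo) \sum_(0 <= k <oo) v (n, k))%E.
  rewrite nneseries_esumT; last by move=> n; exact: nneseries_ge0.
  under [RHS]eq_esum do rewrite nneseries_esumT//.
  rewrite (esum_esum (J := fun=> [set: nat]) (a := fun n k => v (n, k)))//.
  rewrite (_ : _ `*`` _ = [set: nat * nat]); last by apply/seteqP; split => // -[].
  by apply: eq_esum => -[].
apply: lee_lim.
- by apply: is_cvg_nneseries => n _ _; apply: nneseries_ge0 => m *; exact: v_ge0.
- by apply: is_cvg_nneseries => n _ _; rewrite adde_ge0 ?lebesgue_d_ge0.
- by apply: nearW => n; apply: lee_sum => i _; have [_ _] := PG i.
Qed.

Lemma lebesgue_d_fin (L : finType) (P : pred L) (lo hi : L -> Rd) (eta : R) A :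
  (0 < d)%N -> 0 <= eta ->
  (forall l i, tnth (hi l) i = tnth (lo l) i + eta) ->
  (forall x, A x -> exists2 l, P l & box (lo l) (hi l) x) ->
  (lebesgue_d A <= (#|P|%:R * eta ^+ d)%:E)%E.
Proof.
move=> d0 eta0 hl AP.
(* A cover is an infinite sequence, so the finite family is continued by the one-point box at the
   origin, whose volume is a vanishing product because [0 < d]. *)
pose a k := if insub k is Some j then lo (enum_val (j : 'I_#|P|)) else [tuple 0 | i < d].
pose b k := if insub k is Some j then hi (enum_val (j : 'I_#|P|)) else [tuple 0 | i < d].
apply: ereal_inf_lbound; exists a, b; split.
- move=> k i; rewrite /a /b; case: insubP => //= j _ _.
  by rewrite hl lerDl.
- move=> x /AP[l Pl xl]; exists (enum_rank_in Pl l) => //.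
  rewrite /a /b; case: insubP => [j _ /val_inj ->|/=]; last by rewrite ltn_ord.
  by rewrite enum_rankK_in.
- rewrite (nneseries_split 0 #|P|)//=; last first.
    move=> k _; apply: vol_ge0 => i; rewrite /a /b; case: insubP => //= j _ _.
    by rewrite hl lerDl.
  rewrite add0n eseries0 ?adde0; last first.
    move=> k; rewrite /= leqNgt => /negbTE kP _; rewrite /vol /a /b insubF//.
    congr EFin; rewrite (bigD1 (Ordinal d0))//= subrr mul0r//.
  rewrite big_mkord (eq_bigr (fun=> (eta ^+ d)%:E)); last first.
    move=> k _; rewrite /vol /a /b; congr EFin.
    case: insubP => [j _ /val_inj ->|/=]; last by rewrite ltn_ord.
    under eq_bigr do rewrite hl addrAC subrr add0r.
    by rewrite prodr_const card_ord.
  by rewrite sumEFin sumr_const card_ord mulr_natl.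
Qed.

End lebesgue_d_theory.

(** * Level sets of a random trigonometric sum *)

Section level_sets.
Context {R : realType} {d : nat}.
Notation Rd := (d.-tuple R).

Let eq_ler (x y : R) : x = y -> x <= y. Proof. by move->. Qed.

(* Fourier transform of the uniform measure on the centred cube of side [r]. *)
Definition psi (r : R) (xi : Rd) : R := \prod_(a < d) sinc (pi * r * tnth xi a).

(* [th = 0] gives the real part of the character, [th = pi / 2] the imaginary part
   of its conjugate. *)
Definition wave (th : R) (y xi : Rd) : R := cos (2 * pi * dotp y xi + th).

Lemma wave_lip th (y xi xi' : Rd) (e : R) :
  (forall a, `|tnth y a| <= 1) -> (forall a, `|tnth xi a - tnth xi' a| <= e) ->
  `|wave th y xi - wave th y xi'| <= 2 * pi * (d%:R * e).
Proof.
move=> y1 xie; rewrite (le_trans (cos_lip _ _))// opprD addrACA subrr addr0.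
rewrite -mulrBr normrM ger0_norm ?mulr_ge0 ?pi_ge0// ler_wpM2l ?mulr_ge0 ?pi_ge0//.
rewrite /dotp -sumrB (le_trans (ler_norm_sum _ _ _))//.
rewrite -[X in X%:R](card_ord d) mulr_natl -sumr_const ler_sum// => a _.
by rewrite -mulrBr normrM -[leRHS]mul1r ler_pM.
Qed.

Lemma pi_ge1 : 1 <= pi :> R.
Proof. by rewrite (le_trans _ (pi_ge2 R))// ler1n. Qed.

Lemma pi_le4 : pi <= 4 :> R.
Proof. by have /andP[_] := pihalf_02 R; lra. Qed.

Lemma psi_le (r : R) (xi : Rd) (u : 'I_d -> R) : 0 <= r ->
  (forall a, 0 <= u a <= r * `|tnth xi a|) ->
  `|psi r xi| <= 2 ^+ d * \prod_a (1 + u a)^-1.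
Proof.
move=> r0 Hu; rewrite /psi normr_prod.
have -> : 2 ^+ d = \prod_(a < d) 2 :> R by rewrite prodr_const card_ord.
rewrite -big_split/=; apply: ler_prod => a _; rewrite normr_ge0/=.
have /andP[u0 ua] := Hu a.
rewrite (le_trans (sinc_decay _))// ler_wpM2l// lef_pV2 ?posrE ?ltr_wpDr//.
rewrite lerD2l (le_trans ua)// !normrM (ger0_norm r0) -mulrA ler_peMl ?mulr_ge0//.
by rewrite (le_trans pi_ge1)// ler_norm.
Qed.

(** Keeping the decay in a single coordinate is enough to confine level sets to a bounded region. *)
Lemma psi_le1 (r : R) (xi : Rd) (a : 'I_d) : 0 <= r ->
  `|psi r xi| <= 2 / (1 + r * `|tnth xi a|).
Proof.
move=> r0; rewrite /psi (bigD1 a)//= normrM -[leRHS]mulr1 ler_pM//.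
  rewrite (le_trans (sinc_decay _))// ler_wpM2l// lef_pV2 ?posrE ?ltr_wpDr// ?mulr_ge0//.
  rewrite lerD2l !normrM (ger0_norm r0) -mulrA ler_peMl ?mulr_ge0//.
  by rewrite (le_trans pi_ge1)// ler_norm.
by rewrite normr_prod prodr_ile1// => b _; rewrite normr_ge0 sinc_le1.
Qed.

Section sampling.
Variables (I G : finType) (E : {set I}) (y : I -> G -> Rd).
Hypothesis y1 : forall i g a, `|tnth (y i g) a| <= 1.
Hypothesis E0 : (0 < #|E|)%N.
Hypothesis G0 : (0 < #|G|)%N.

(* [w i] selects the random sample in cell [i]; the expectation is subtracted. *)
Definition cwave th i g xi :=
  wave th (y i g) xi - #|G|%:R^-1 * \sum_g' wave th (y i g') xi.

Definition fluct (w : {ffun I -> G}) th xi := \sum_(i in E) cwave th i (w i) xi.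

Let GR : 0 < #|G|%:R :> R. Proof. by rewrite ltr0n. Qed.

Lemma cwave_le2 th i g xi : `|cwave th i g xi| <= 2.
Proof.
rewrite (le_trans (ler_normB _ _))// (_ : 2 = 1 + 1)// lerD ?cos_max//.
rewrite normrM normfV (ger0_norm (ltW GR)) ler_pdivrMl// mulr1.
rewrite (le_trans (ler_norm_sum _ _ _))// -sumr_const ler_sum// => ? _.
exact: cos_max.
Qed.

Lemma cwave_mean0 th i xi : \sum_g cwave th i g xi = 0.
Proof.
rewrite sumrB sumr_const -[X in _ - X]mulr_natl mulrA divff ?mul1r ?subrr//.
by rewrite gt_eqF.
Qed.

Lemma cwave_lip th i g xi xi' e :
  (forall a, `|tnth xi a - tnth xi' a| <= e) ->
  `|cwave th i g xi - cwave th i g xi'| <= 4 * pi * (d%:R * e).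
Proof.
move=> xie; rewrite /cwave opprD addrACA -opprD -mulrBr -sumrB.
have -> : 4 * pi * (d%:R * e) = 2 * pi * (d%:R * e) + 2 * pi * (d%:R * e) by ring.
rewrite (le_trans (ler_normB _ _))// lerD ?wave_lip//.
rewrite normrM normfV (ger0_norm (ltW GR)) ler_pdivrMl//.
rewrite (le_trans (ler_norm_sum _ _ _))// [leRHS]mulr_natl -sumr_const ler_sum// => ? _.
exact: wave_lip.
Qed.

Lemma fluct_le w th xi : `|fluct w th xi| <= 2 * #|E|%:R.
Proof.
rewrite (le_trans (ler_norm_sum _ _ _))// mulr_natr -sumr_const ler_sum// => ? _.
exact: cwave_le2.
Qed.

(** No cancellation between the terms is used. This crude bound only forces small cells, and the
    side of the cells cancels from the final estimate of the measure. *)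
Lemma fluct_lip w th xi xi' e : (0 < d)%N ->
  (forall a, `|tnth xi a - tnth xi' a| <= e) ->
  e <= (16 * d%:R * Num.sqrt #|E|%:R)^-1 ->
  `|fluct w th xi - fluct w th xi'| <= Num.sqrt #|E|%:R.
Proof.
move=> d0 xie e1.
have s0 : 0 < Num.sqrt #|E|%:R :> R by rewrite sqrtr_gt0 ltr0n.
have dR : 0 < d%:R :> R by rewrite ltr0n.
rewrite -sumrB (le_trans (ler_norm_sum _ _ _))//.
apply: (@le_trans _ _ (\sum_(i in E) (Num.sqrt #|E|%:R)^-1)).
  apply: ler_sum => i _; rewrite (le_trans (cwave_lip _ _ _ xie))//.
  apply: (@le_trans _ _ (16 * d%:R * (16 * d%:R * Num.sqrt #|E|%:R)^-1)).
    rewrite mulrA ler_pM//.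
    - by rewrite !mulr_ge0// ?pi_ge0// ltW.
    - by rewrite (le_trans (normr_ge0 _) (xie (Ordinal d0))).
    - by have := pi_le4; nra.
  by rewrite invfM mulrA divff ?mul1r// gt_eqF// mulr_gt0.
by rewrite sumr_const -[leLHS]mulr_natl ler_pdivrMr// -expr2 sqr_sqrtr.
Qed.

(* Frequency space is cut into cells so small that [fluct] varies by at most
   [sqrt #|E|] on each of them; on a cell [psi] is bounded by the summable weight [U].
   The sub-Gaussian bound and Chebyshev's inequality for the powers [2 <= j <= m]
   then count the cells that meet the level set.  The summand [sqrt #|E|] keeps the
   bound meaningful when [fluct] vanishes. *)
Lemma level_set_le (r : R) (m : nat) : (0 < d)%N -> 0 < r <= 1 -> (2 <= m)%N ->
  exists w : {ffun I -> G}, forall (a s : R) j, 0 < a -> 0 < s -> (2 <= j <= m)%N ->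
  (lebesgue_d [set xi | (s <= a * `|psi r xi| *
      (Num.sqrt #|E|%:R + (`|fluct w 0 xi| + `|fluct w (pi / 2) xi|)))%R] <=
   (8 * 4 ^+ d * (2 ^+ d * (16 * m%:R)) ^+ m * r ^- d *
     (a * Num.sqrt #|E|%:R / s) ^+ j)%:E)%E.
Proof.
move=> d0 /andP[r0 r1] m2.
have dR : 1 <= d%:R :> R by rewrite ler1n.
have ER : 1 <= #|E|%:R :> R by rewrite ler1n.
set q := Num.sqrt #|E|%:R.
have q1 : 1 <= q by rewrite -sqrtr1 ler_wsqrtr.
pose eta := (16 * d%:R * q)^-1.
have eta0 : 0 < eta by rewrite invr_gt0 !mulr_gt0//; lra.
have eta1 : eta <= 1 by rewrite invf_le1; [nra|rewrite !mulr_gt0//; lra].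
pose h := eta * r.
have h01 : 0 < h <= 1 by rewrite mulr_gt0//= mulr_ile1// ltW.
have /andP[h0 h1] := h01.
(* For each coordinate a cell records the sign and the distance from zero in units of [eta], so that
   the weight depends on the distance only. On the negative side the lower end is therefore one unit
   further out. *)
pose cell L := {ffun 'I_d -> bool * 'I_L}.
pose lo L (l : cell L) : Rd := [tuple
  if (l i).1 then - (eta * (l i).2.+1%:R) else eta * (l i).2%:R | i < d].
pose hi L (l : cell L) : Rd := [tuple tnth (lo L l) i + eta | i < d].
pose U L (l : cell L) := \prod_(i < d) (1 + h * (l i).2%:R)^-1.
have u01 L (l : cell L) i : 0 <= (1 + h * (l i).2%:R)^-1 <= 1.
  have ? : 0 <= h * (l i).2%:R by rewrite mulr_ge0// ltW.
  by rewrite invr_ge0 addr_ge0//= invf_le1 ?ler_wpDr// ltr_wpDr.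
have U0 L l : 0 <= U L l by apply: prodr_ge0 => i _; have /andP[] := u01 L l i.
have U1 L l : U L l <= 1 by apply: prodr_ile1 => i _; exact: u01.
(* The sum factorizes over the coordinates. Squares are needed: the sums of the first powers grow
   with [L]. In [4 / h] one factor 2 comes from [sum_inv_sqr] and one from the two signs. *)
have sumU L : \sum_l U L l ^+ 2 <= (4 / h) ^+ d.
  pose F (i : 'I_d) (bz : bool * 'I_L) := (1 + h * bz.2%:R) ^- 2.
  have -> : \sum_l U L l ^+ 2 = \prod_i \sum_bz F i bz.
    rewrite (bigA_distr_bigA F); apply: eq_bigr => l _; rewrite /U -prodrXl.
    by apply: eq_bigr => i _; rewrite exprVn.
  rewrite -[X in _ ^+ X](card_ord d) -prodr_const; apply: ler_prod => i _.
  rewrite sumr_ge0/=; last by move=> *; rewrite invr_ge0 sqr_ge0.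
  rewrite (_ : \sum_bz F i bz = \sum_b \sum_z F i (b, z)); last first.
    by rewrite pair_bigA; apply: eq_bigr => -[].
  have := sum_inv_sqr L h01; set S := \sum_(_ < _) _ => HS.
  rewrite big_bool/= (_ : 4 / h = 2 / h + 2 / h) ?lerD//; by rewrite -mulrDl; congr (_ / _); lra.
pose V w th xi := expch (fluct w th xi / q).
pose W L w := \sum_(l : cell L) U L l ^+ 2 * (V w 0 (lo L l) + V w (pi / 2) (lo L l)).
have Vmean th xi : \sum_w V w th xi <= 4 * #|{ffun I -> G}|%:R.
  apply: (@subgauss_expch R I G E (fun i g => cwave th i g xi)) => // *.
    exact: cwave_le2.
  exact: cwave_mean0.
have [||w Hw] := @pigeonhole_bound R {ffun I -> G} W (8 * (4 / h) ^+ d).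
- by rewrite card_ffun expn_gt0 G0.
- move=> L; rewrite /W exchange_big/=.
  apply: (@le_trans _ _ (\sum_l U L l ^+ 2 * (8 * #|{ffun I -> G}|%:R))).
    apply: ler_sum => l _; rewrite -mulr_sumr ler_wpM2l ?sqr_ge0// big_split/=.
    apply: le_trans (lerD (Vmean _ _) (Vmean _ _)) _.
    by rewrite -mulrDl ler_wpM2r//; lra.
  by rewrite -mulr_suml mulrA ler_wpM2r// mulrC ler_wpM2l.
exists w => a s j a0 s0 /andP[j2 jm].
(* Beyond [eta * L] in some coordinate the level set is empty: [psi_le1] contributes the factor 2,
   and the trivial bound [2 * #|E|] on each of the two fluctuations, with [q <= #|E|], the factor
   5. *)
pose bnd := 10 * a * #|E|%:R / s / (r * eta).
have bnd0 : 0 <= bnd.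
  have [? ?] := (ltW a0, ltW s0); have [? ?] := (ltW r0, ltW eta0).
  by rewrite /bnd !divr_ge0 ?mulr_ge0//; lra.
have [L LL0 HL] := Hw (Num.bound bnd).
have {LL0} bL : bnd < L%:R.
  by rewrite (lt_le_trans (archi_boundP bnd0))// ler_nat.
(* The 3 collects the summand [q] of the level function and the variation, at most [q], of each of
   the two fluctuations on the cell, all divided by [q]. *)
pose X (l : cell L) :=
  3 + `|fluct w 0 (lo L l) / q| + `|fluct w (pi / 2) (lo L l) / q|.
pose x := s / (a * q).
have aq0 : 0 < a * q by rewrite mulr_gt0//; lra.
have x0 : 0 < x by rewrite divr_gt0.
pose P (l : cell L) := x <= 2 ^+ d * U L l * X l.
have tlo l i : tnth (lo L l) i =
    if (l i).1 then - (eta * (l i).2.+1%:R) else eta * (l i).2%:R.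
  by rewrite tnth_mktuple.
have thi l i : tnth (hi L l) i = tnth (lo L l) i + eta by rewrite tnth_mktuple.
apply: le_trans (lebesgue_d_fin (P := P) d0 (ltW eta0) thi _) _.
  move=> xi /= sxi.
  have xib i : `|tnth xi i| < eta * L%:R.
    move: bL; rewrite /bnd ltr_pdivrMr ?mulr_gt0// => bL.
    have [//|xiL] := ltP; exfalso.
    have rx : 1 + r * `|tnth xi i| > 10 * a * #|E|%:R / s.
      apply: lt_le_trans bL _; rewrite (@le_trans _ _ (r * `|tnth xi i|))//.
        by rewrite mulrCA ler_pM2l// mulrC.
      by rewrite lerDr.
    have rx0 : 0 < 1 + r * `|tnth xi i| by rewrite ltr_wpDr// mulr_ge0// ltW.
    move: rx; rewrite ltr_pdivrMr// => rx.
    have /= := psi_le1 xi i (ltW r0); rewrite ler_pdivlMr// => p1.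
    have f0 := fluct_le w 0 xi; have f1 := fluct_le w (pi / 2) xi.
    move: sxi; apply/negP; rewrite -ltNge.
    rewrite -(ltr_pM2l rx0) (le_lt_trans _ rx)//.
    rewrite [leLHS](_ : _ = a * (`|psi r xi| * (1 + r * `|tnth xi i|)) *
      (q + (`|fluct w 0 xi| + `|fluct w (pi / 2) xi|))); last by ring.
    rewrite (_ : 10 * a * #|E|%:R = a * 2 * (5 * #|E|%:R)); last by ring.
    have qE : q <= #|E|%:R by rewrite -[leRHS]sqr_sqrtr// -/q; nra.
    apply: ler_pM => //.
    - by rewrite !mulr_ge0// ltW.
    - by rewrite !addr_ge0//; lra.
    - by rewrite ler_pM2l.
    - by rewrite (le_trans (lerD qE (lerD f0 f1)))//; lra.
  pose zz i := Num.trunc (`|tnth xi i| / eta).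
  have zzP i : eta * (zz i)%:R <= `|tnth xi i| < eta * (zz i).+1%:R.
    have /trunc_itv : 0 <= `|tnth xi i| / eta by rewrite divr_ge0// ltW.
    by rewrite -/(zz i) ler_pdivlMr// ltr_pdivrMr// ![eta * _]mulrC.
  have zzL i : (zz i < L)%N.
    have /andP[z1 _] := zzP i; have := le_lt_trans z1 (xib i).
    by rewrite ltr_pM2l// ltr_nat.
  pose l : cell L := [ffun i => (tnth xi i < 0, Ordinal (zzL i))].
  have lbox i : tnth (lo L l) i <= tnth xi i <= tnth (lo L l) i + eta.
    rewrite tlo ffunE/=; have /andP[z1 z2] := zzP i.
    have ez : eta * (zz i).+1%:R = eta * (zz i)%:R + eta by rewrite -natr1; ring.
    move: z1 z2; rewrite ez; have [xi0|xi0] := ltP (tnth xi i) 0.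
      by rewrite ltr0_norm// => *; apply/andP; split; lra.
    by rewrite ger0_norm// => *; apply/andP; split; lra.
  exists l; last by move=> i; rewrite thi; exact: lbox.
  have dist i : `|tnth xi i - tnth (lo L l) i| <= eta.
    by have /andP[? ?] := lbox i; rewrite ger0_norm ?subr_ge0// lerBlDl.
  have fl th : `|fluct w th xi| <= q * (1 + `|fluct w th (lo L l) / q|).
    have q0 : 0 < q by lra.
    rewrite mulrDr mulr1 normrM normfV (ger0_norm (ltW q0)) mulrCA divff ?gt_eqF// mulr1.
    have := fluct_lip w th d0 dist (lexx _); rewrite -/q.
    have := ler_normD (fluct w th xi - fluct w th (lo L l)) (fluct w th (lo L l)).
    by rewrite subrK; lra.
  rewrite /P /x ler_pdivrMr// (le_trans sxi)//.
  have pU : `|psi r xi| <= 2 ^+ d * U L l.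
    apply: psi_le => [|i]; first exact: ltW.
    rewrite ffunE/= mulr_ge0//=; last exact: ltW.
    by rewrite /h mulrAC mulrC ler_pM2l//; have /andP[] := zzP i.
  rewrite [leRHS](_ : _ = a * (2 ^+ d * U L l) * (q * X l)); last by ring.
  apply: ler_pM => //.
  - by rewrite mulr_ge0// ltW.
  - by rewrite !addr_ge0//; lra.
  - by rewrite ler_pM2l.
  rewrite (le_trans (lerD (lexx q) (lerD (fl _) (fl _))))//.
  by rewrite /X; apply: eq_ler; ring.
rewrite lee_fin.
have X1 l : 1 <= X l.
  by rewrite /X -addrA ler_wpDr ?addr_ge0//; lra.
have Xm l : X l ^+ m <= (16 * m%:R) ^+ m * (V w 0 (lo L l) + V w (pi / 2) (lo L l)).
  have m0 : (0 < m)%N by exact: leq_trans m2.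
  set z0 := fluct w 0 (lo L l) / q; set z1 := fluct w (pi / 2) (lo L l) / q.
  have : X l <= 2 * Num.max (2 + `|z0|) (2 + `|z1|).
    rewrite /X -/z0 -/z1.
    have : 2 + `|z0| <= Num.max (2 + `|z0|) (2 + `|z1|) by rewrite le_max lexx.
    have : 2 + `|z1| <= Num.max (2 + `|z0|) (2 + `|z1|) by rewrite le_max lexx orbT.
    by lra.
  move=> /(lerXn2r m) H; apply: le_trans (H _ _) _.
  - by rewrite nnegrE (le_trans ler01).
  - by rewrite nnegrE mulr_ge0// le_max addr_ge0.
  have -> : (16 * m%:R) ^+ m = 2 ^+ m * (8 * m%:R) ^+ m :> R.
    by rewrite -exprMn; congr (_ ^+ m); ring.
  rewrite exprMn -mulrA ler_wpM2l ?exprn_ge0// mulrDr.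
  have e0 := expch_ge z0 m0; have e1 := expch_ge z1 m0.
  rewrite /V -/z0 -/z1; have [_|_] := leP (2 + `|z0|) (2 + `|z1|).
    by rewrite (le_trans e1)// lerDr mulr_ge0 ?exprn_ge0// addr_ge0 ?expR_ge0.
  by rewrite (le_trans e0)// lerDl mulr_ge0 ?exprn_ge0// addr_ge0 ?expR_ge0.
(* Chebyshev's inequality, with every exponent replaced by its worst case: since [0 <= U <= 1 <= X]
   and [2 <= j <= m], the [j]-th power of [U * X] is at most [U ^ 2 * X ^ m]. One weighted sum thus
   serves all [j]. *)
have cardP : #|P|%:R * x ^+ j <= \sum_l (2 ^+ d) ^+ m * (U L l ^+ 2 * X l ^+ m).
  rewrite -sum1_card natr_sum mulr_suml.
  apply: (@le_trans _ _ (\sum_(l in P) (2 ^+ d) ^+ m * (U L l ^+ 2 * X l ^+ m))); last first.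
    rewrite big_mkcond/=; apply: ler_sum => l _; case: ifP => // _.
    by rewrite !mulr_ge0 ?exprn_ge0// (le_trans ler01).
  apply: ler_sum => l Pl'; have {Pl'} Pl : P l := Pl'; rewrite mul1r.
  apply: (@le_trans _ _ ((2 ^+ d * U L l * X l) ^+ j)).
    by apply: lerXn2r => //; rewrite nnegrE ?(ltW x0)// (le_trans (ltW x0)).
  rewrite !exprMn -mulrA ler_pM ?exprn_ge0//.
  - by rewrite mulr_ge0 ?exprn_ge0// (le_trans ler01).
  - by rewrite ler_weXn2l// exprn_ege1// ler1n.
  - rewrite ler_pM ?exprn_ge0//; [exact: le_trans (X1 l)| |exact: ler_weXn2l].
    by rewrite ler_wiXn2l.
rewrite -(ler_pM2r (exprn_gt0 j x0)) mulrAC.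
apply: (@le_trans _ _ ((2 ^+ d) ^+ m * (16 * m%:R) ^+ m * (8 * (4 / h) ^+ d) * eta ^+ d)).
  rewrite ler_wpM2r ?exprn_ge0 ?(ltW eta0)// (le_trans cardP)// -mulr_sumr.
  rewrite -mulrA ler_wpM2l ?exprn_ge0//.
  apply: (@le_trans _ _ (\sum_l (16 * m%:R) ^+ m * (U L l ^+ 2 * (V w 0 (lo L l) + V w (pi / 2) (lo L l))))).
    apply: ler_sum => l _; rewrite mulrCA ler_wpM2l ?sqr_ge0//.
  by rewrite -mulr_sumr ler_wpM2l// exprn_ge0.
apply: eq_ler.
have E1 : (a * q / s) ^+ j * x ^+ j = 1.
  by rewrite -exprMn /x -invf_div mulVf ?expr1n// gt_eqF.
rewrite -[RHS]mulrA E1 mulr1 /h expr_div_n !exprMn; field.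
by rewrite !expf_neq0// gt_eqF.
Qed.

End sampling.
End level_sets.

(** * Refining a mixture of cubes *)

Section sums.

Lemma sum_divn_modn (V : nmodType) (K B : nat) (F : nat -> nat -> V) : (0 < B)%N ->
  \sum_(i < K * B) F (i %/ B)%N (i %% B)%N = \sum_(i < K) \sum_(b < B) F i b.
Proof.
move=> B0; elim: K => [|K IH]; first by rewrite mul0n !big_ord0.
rewrite mulSnr big_split_ord/= [RHS]big_ord_recr/= IH; congr (_ + _).
by apply: eq_bigr => b _; rewrite divnMDl// modnMDl divn_small// modn_small// addn0.
Qed.

Lemma sum_modn (V : nmodType) (c a : nat) (F : nat -> V) : (0 < a)%N ->
  \sum_(b < c * a) F (b %% a)%N = (\sum_(s < a) F s) *+ c.
Proof.
move=> a0; rewrite (@sum_divn_modn _ c a (fun _ b => F b))//.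
by rewrite sumr_const card_ord.
Qed.

Lemma card_divn_eq (K n e k : nat) : K = (n * e)%N -> (0 < e)%N -> (k < n)%N ->
  #|[set i : 'I_K | (i %/ e == k)%N]%SET| = e.
Proof.
move=> -> e0 kn; rewrite -sum1_card big_mkcond/=.
under eq_bigr do rewrite inE.
rewrite (@sum_divn_modn nat n e (fun i _ => if i == k then 1%N else 0%N))//.
rewrite (bigD1 (Ordinal kn))//= eqxx sum_nat_const card_ord muln1 big1; first exact: addn0.
move=> i /negbTE ik; rewrite -val_eqE/= in ik.
by rewrite ik big1.
Qed.

End sums.

Section step.
Context {R : realType} {d : nat}.
Notation Rd := (d.-tuple R).

(** Centre of the [g]-th of the [D ^ d] equal subcubes of the cube with centre [x] and side [r]. *)
Definition subc (x : Rd) (r : R) (D : nat) (g : {ffun 'I_d -> 'I_D}) : Rd :=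
  [tuple tnth x a + r * ((2 * (g a)%:R + 1 - D%:R) / (2 * D%:R)) | a < d].

(** The uniform measure on a cube is the mean of those on its subcubes; [psi] is the transform of
    the shape and [wave] that of the centre. *)
Lemma subc_mean (x xi : Rd) r D th : (0 < D)%N ->
  (\sum_g wave th (subc x r (D := D) g) xi) * psi (r / D%:R) xi =
  (D ^ d)%:R * (wave th x xi * psi r xi).
Proof.
move=> D0; have DR : D%:R != 0 :> R by rewrite pnatr_eq0 -lt0n.
rewrite mulr_suml.
have := mean_cos_grid (fun a => pi * (r / D%:R) * tnth xi a) (2 * pi * dotp x xi + th) D0.
under [in X in _ = X -> _]eq_bigr => a _.
  rewrite (_ : D%:R * (pi * (r / D%:R) * tnth xi a) = pi * r * tnth xi a); last by field.
  over.
move=> <-; apply: eq_bigr => g _; congr (cos _ * _).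
rewrite addrAC; congr (_ + th); rewrite /dotp !mulr_sumr -big_split/=.
by apply: eq_bigr => a _; rewrite tnth_mktuple; field.
Qed.

(** The subcube lies inside the cube. Nesting is passed on in this coordinatewise form up to the
    limit measure. *)
Lemma subc_in (x : Rd) r D (g : {ffun 'I_d -> 'I_D}) a : 0 <= r ->
  `|tnth (subc x r g) a - tnth x a| + r / D%:R / 2 <= r / 2.
Proof.
move=> r0; have D0 : (0 < D)%N by case: (g a) => j /= /(leq_trans _); apply.
have DR : 1 <= D%:R :> R by rewrite ler1n.
rewrite tnth_mktuple addrAC subrr add0r normrM (ger0_norm r0).
have : `|(2 * (g a)%:R + 1 - D%:R) / (2 * D%:R)| <= (D%:R - 1) / (2 * D%:R) :> R.
  rewrite normrM normfV (@ger0_norm _ (2 * D%:R)) ?mulr_ge0// ler_wpM2r ?invr_ge0 ?mulr_ge0//.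
  have : 1 + (g a)%:R <= D%:R :> R by rewrite nat1r ler_nat.
  have : 0 <= (g a)%:R :> R by [].
  by rewrite ler_norml => *; apply/andP; split; lra.
move=> /(ler_wpM2l r0) H.
rewrite (_ : r / 2 = r * ((D%:R - 1) / (2 * D%:R)) + r / D%:R / 2) ?lerD2r//.
by field; lra.
Qed.

(* Real ([th = 0]) or imaginary ([th = pi / 2]) part of the Fourier transform of the
   equal-weight mixture of the uniform measures on the cubes of side [r] centred at
   [x 0, ..., x (K - 1)]. *)
Definition FT (K : nat) (r : R) (x : nat -> Rd) (th : R) (xi : Rd) : R :=
  K%:R^-1 * (\sum_(i < K) wave th (x i) xi) * psi r xi.

Section refine.
Variables (K : nat) (r : R) (x : nat -> Rd) (D J n' : nat) (A : pred nat).
Variable w : {ffun 'I_K * 'I_J -> {ffun 'I_d -> 'I_D}}.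
Variables (i0 : 'I_K) (s0 : 'I_J) (D0 : (0 < D)%N) (n'0 : (0 < n')%N).
Notation G := {ffun 'I_d -> 'I_D}.
Let g0 : G := [ffun=> Ordinal D0].
Let B := (n' * J * #|{: G}|)%N.

Let G0 : (0 < #|{: G}|)%N. Proof. by apply/card_gt0P; exists g0. Qed.
Let J0 : (0 < J)%N. Proof. by case: s0 => j /= /(leq_trans _); apply. Qed.
Let K0 : (0 < K)%N. Proof. by case: i0 => j /= /(leq_trans _); apply. Qed.

(* Each cube gets [B] children.  An active cube ([A i]) is replaced by [J] random
   subcubes, an inactive one by all of them; the multiplicities make both counts
   equal to [B]. *)
Definition refine_digit (i b : nat) : G :=
  if A i then w (insubd i0 i, insubd s0 (b %% J)%N) else nth g0 (enum {: G}) (b %% #|{: G}|).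

Definition refine (i' : nat) : Rd :=
  subc (x (i' %/ B)%N) r (refine_digit (i' %/ B) (i' %% B)).

(** Over its children an active cube yields the mean over all subcubes plus a fluctuation, an
    inactive one the mean alone. Each of the [J] samples occurs [n' * #|G|] times and, in an
    inactive cube, each subcube [n' * J] times; [n'] makes the new number of cubes divisible by the
    number of fractions of the next step. *)
Lemma refine_sum th xi :
  \sum_(i' < K * B) wave th (refine i') xi =
  (n' * #|{: G}|)%:R * fluct [set p : 'I_K * 'I_J | A p.1]%SET
     (fun p g => subc (x p.1) r g) w th xi +
  (n' * J)%:R * \sum_(i < K) \sum_g wave th (subc (x i) r (D := D) g) xi.
Proof.
have GR : #|{: G}|%:R != 0 :> R by rewrite pnatr_eq0 -lt0n.
rewrite /refine (@sum_divn_modn _ K B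
  (fun i b => wave th (subc (x i) r (refine_digit i b)) xi)) ?muln_gt0 ?n'0 ?J0//.
pose S (i : 'I_K) := \sum_g wave th (subc (x i) r (D := D) g) xi.
have -> : fluct [set p : 'I_K * 'I_J | A p.1]%SET (fun p g => subc (x p.1) r g) w th xi =
  \sum_(i < K) if A i then \sum_(s < J) (wave th (subc (x i) r (w (i, s))) xi - #|{: G}|%:R^-1 * S i) else 0.
  rewrite /fluct big_mkcond/=.
  transitivity (\sum_(i < K) \sum_(s < J) if A (val i) then
     wave th (subc (x i) r (w (i, s))) xi - #|{: G}|%:R^-1 * S i else 0).
    rewrite pair_bigA; apply: eq_bigr => -[i s] _ /=; rewrite inE/=.
    by case: ifP.
  by apply: eq_bigr => i _; case: ifP => // _; rewrite big1.
rewrite !mulr_sumr -big_split/=; apply: eq_bigr => i _.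
rewrite /refine_digit -/(S i); case: ifP => Ai.
  rewrite /B (mulnAC n') (@sum_modn _ (n' * _) J (fun b =>
    wave th (subc (x i) r (w (insubd i0 (val i), insubd s0 b))) xi))//.
  rewrite sumrB sumr_const card_ord.
  under eq_bigr do rewrite !valKd.
  rewrite -[LHS]mulr_natl !natrM -[X in _ - X]mulr_natl; field.
  exact: GR.
rewrite /B (@sum_modn _ (n' * J) #|{: G}| (fun b =>
    wave th (subc (x i) r (nth g0 (enum {: G}) b)) xi))//.
rewrite mulr0 add0r -[LHS]mulr_natl; congr (_ * _).
by rewrite /S -[RHS]big_enum/= [RHS](big_nth g0) -cardE big_mkord.
Qed.

(** By [subc_mean] the mean part of [refine_sum] reproduces the old transform exactly, so only the
    fluctuation is left. *)
Lemma refine_FT th xi :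
  FT (K * B) (r / D%:R) refine th xi - FT K r x th xi =
  (K%:R * J%:R)^-1 * psi (r / D%:R) xi *
    fluct [set p : 'I_K * 'I_J | A p.1]%SET (fun p g => subc (x p.1) r g) w th xi.
Proof.
rewrite /FT refine_sum.
set F := fluct _ _ _ _ _; set S := \sum_(i < K) \sum_g _.
have SE : S * psi (r / D%:R) xi =
    #|{: G}|%:R * ((\sum_(i < K) wave th (x i) xi) * psi r xi).
  rewrite !mulr_suml mulr_sumr; apply: eq_bigr => i _.
  by rewrite subc_mean// card_ffun !card_ord.
have [GR KR] : #|{: G}|%:R != 0 :> R /\ K%:R != 0 :> R by rewrite !pnatr_eq0 -!lt0n.
have [JR nR] : J%:R != 0 :> R /\ n'%:R != 0 :> R by rewrite !pnatr_eq0 -!lt0n.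
rewrite /B !natrM.
rewrite (_ : _ * psi (r / D%:R) xi =
  (K%:R * J%:R)^-1 * psi (r / D%:R) xi * F + (K%:R * #|{: G}|%:R)^-1 * (S * psi (r / D%:R) xi)).
  by rewrite SE; field; rewrite GR KR JR.
by field; rewrite GR KR JR nR.
Qed.

End refine.
End step.

Section step_lemma.
Context {R : realType} {d : nat}.
Notation Rd := (d.-tuple R).

(** The length [2 * d ^ 2 * r'], with [r' = r / D], bounds the diameter of a ball of radius
    [d * r'], which will contain a cube of side [r']. First [D] is made so large that one subcube in
    each of the [e] active cubes costs at most [t]; then [J] is the integer part of [t] divided by
    this cost, which is at least 1, so rounding loses at most a factor 2. *)
Lemma subdivision_scale (e : nat) (r t rho al : R) : (0 < d)%N -> (0 < e)%N -> 0 < r ->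
  0 < t -> 0 < rho -> 0 < al ->
  exists D J : nat, [/\ (0 < D)%N, (0 < J)%N, r / D%:R <= rho,
    (e * J)%:R * powR (2 * d%:R ^+ 2 * (r / D%:R)) al <= t &
    t <= 2 * (e * J)%:R * powR (2 * d%:R ^+ 2 * (r / D%:R)) al].
Proof.
move=> d0 e0 r0 t0 rho0 al0.
have eR : 0 < e%:R :> R by rewrite ltr0n.
have cR : 0 < 2 * d%:R ^+ 2 :> R by rewrite mulr_gt0// exprn_gt0// ltr0n.
pose u := powR (t / e%:R) al^-1.
have u0 : 0 < u by rewrite powR_gt0// divr_gt0.
have [D HD] : exists D : nat, r / rho + 2 * d%:R ^+ 2 * r / u < D%:R.
  exists (Num.bound (r / rho + 2 * d%:R ^+ 2 * r / u)); apply: archi_boundP.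
  by rewrite addr_ge0// divr_ge0// ?mulr_ge0// ltW.
have h1 : 0 < r / rho by rewrite divr_gt0.
have h2 : 0 < 2 * d%:R ^+ 2 * r / u by rewrite divr_gt0// mulr_gt0.
have DR : 0 < D%:R :> R by lra.
pose v := powR (2 * d%:R ^+ 2 * (r / D%:R)) al.
have v0 : 0 < v by rewrite powR_gt0// mulr_gt0// divr_gt0.
have ve : v * e%:R <= t.
  have -> : t = powR u al * e%:R.
    rewrite /u -powRrM mulVf ?gt_eqF// powRr1 ?divr_ge0 ?(ltW t0)//.
    by rewrite divfK// gt_eqF.
  rewrite ler_pM2r// /v ge0_ler_powR ?nnegrE ?powR_ge0 ?(ltW al0) ?(ltW u0)//.
    by rewrite ltW// mulr_gt0// divr_gt0.
  rewrite mulrA ler_pdivrMr// -ler_pdivrMl// mulrC -/u.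
  by apply: ltW; lra.
pose T := t / (v * e%:R).
have T1 : 1 <= T by rewrite ler_pdivlMr ?mulr_gt0// mul1r.
have /truncn_itv/andP[JT TJ] : 0 <= T by lra.
have J0 : (0 < Num.trunc T)%N by rewrite truncn_gt0.
have J1 : 1 <= (Num.trunc T)%:R :> R by rewrite ler1n.
exists D, (Num.trunc T); split => //.
- by rewrite -(ltr0n R).
- by rewrite ler_pdivrMr// -ler_pdivrMl// mulrC; apply: ltW; lra.
- rewrite -/v natrM; move: JT; rewrite ler_pdivlMr ?mulr_gt0// => JT.
  by rewrite (le_trans _ JT)//; rewrite le_eqVlt; apply/orP; left; apply/eqP; ring.
- rewrite -/v natrM; move: TJ; rewrite -natr1 ltr_pdivrMr ?mulr_gt0// => TJ.
  apply: (le_trans (ltW TJ)).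
  rewrite [leRHS](_ : _ = (2 * (Num.trunc T)%:R) * (v * e%:R)); last by ring.
  by rewrite ler_pM2r ?mulr_gt0//; lra.
Qed.

(* The active cubes are those with [i %/ e = k], a fraction [1 / n] of all cubes. *)
Lemma refinement_step (p : R) (m : nat) : (0 < d)%N -> 2 < p -> (2 <= m)%N ->
  exists2 C : R, 0 < C &
  forall (K : nat) (r : R) (x : nat -> Rd) (n e k n' : nat) (t rho : R),
  0 < r <= 1 -> (forall i a, `|tnth (x i) a| + r / 2 <= 1) ->
  K = (n * e)%N -> (0 < e)%N -> (k < n)%N -> (0 < n')%N -> 0 < t -> 0 < rho ->
  exists (B : nat) (r' : R) (x' : nat -> Rd),
  [/\ [/\ (0 < B)%N, (n' %| B)%N, 0 < r', r' <= rho & r' <= r],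
      (forall i' a, `|tnth (x' i') a - tnth (x (i' %/ B)%N) a| + r' / 2 <= r / 2),
      (exists (N : nat) (g : nat -> Rd), [/\ (0 < N)%N,
         N%:R * powR (2 * d%:R ^+ 2 * r') (2 * d%:R / p) <= t &
         forall i', (i' < K * B)%N -> (i' %/ B %/ e = k)%N -> exists2 s, (s < N)%N & x' i' = g s]) &
      forall (s : R) (j : nat), 0 < s -> (2 <= j <= m)%N ->
      (lebesgue_d [set xi | (s <= `|FT (K * B) r' x' 0 xi - FT K r x 0 xi| +
         `|FT (K * B) r' x' (pi / 2) xi - FT K r x (pi / 2) xi|)%R] <=
       (C * r' ^- d * (n%:R^-1 * powR t (- 2^-1) * powR r' (d%:R / p) / s) ^+ j)%:E)%E].
Proof.
move=> d0 p2 m2.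
have p0 : 0 < p by lra.
have dR : 1 <= d%:R :> R by rewrite ler1n.
pose c := 2 * d%:R ^+ 2 : R.
have c1 : 1 <= c by rewrite /c; nra.
pose C1 := Num.sqrt 2 * powR c (d%:R / p).
have s21 : 1 <= Num.sqrt 2 :> R by rewrite -[leLHS]sqrtr1 ler_wsqrtr// ler1n.
have C11 : 1 <= C1.
  rewrite /C1 -[leLHS]mulr1 ler_pM//.
  rewrite -[leLHS](powRr0 c) ler_powR// divr_ge0//. exact: ltW.
pose C0 := 8 * 4 ^+ d * (2 ^+ d * (16 * m%:R)) ^+ m : R.
have C00 : 0 < C0.
  by rewrite /C0 !mulr_gt0 ?exprn_gt0// ?mulr_gt0// ltr0n (leq_trans _ m2).
exists (C0 * C1 ^+ m); first by rewrite mulr_gt0// exprn_gt0//; lra.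
move=> K r x n e k n' t rho /andP[r0 r1] xr KE e0 kn n'0 t0 rho0.
have n0 : (0 < n)%N by apply: leq_trans kn.
have al0 : 0 < 2 * d%:R / p by rewrite divr_gt0// mulr_gt0//; lra.
have [D [J [D0 J0 rD Jt tJ]]] := subdivision_scale d0 e0 r0 t0 rho0 al0.
have DR : 1 <= D%:R :> R by rewrite ler1n.
have K0 : (0 < K)%N by rewrite KE muln_gt0 n0.
pose r' := r / D%:R.
have r'0 : 0 < r' by rewrite divr_gt0//; lra.
have r'r : r' <= r by rewrite ler_pdivrMr; nra.
pose G : finType := {ffun 'I_d -> 'I_D}.
pose A : pred nat := fun i => (i %/ e == k)%N.
pose E := [set q : 'I_K * 'I_J | A q.1]%SET.
pose y (q : 'I_K * 'I_J) (g : G) := subc (x q.1) r g.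
have y1 q g a : `|tnth (y q g) a| <= 1.
  have := subc_in (x q.1) g a (ltW r0).
  have := ler_normD (tnth (y q g) a - tnth (x q.1) a) (tnth (x q.1) a).
  rewrite subrK -/(y q g) -/r'; have := xr q.1 a; lra.
have cE : #|E| = (e * J)%N.
  have -> : E = finset.setX [set i : 'I_K | (i %/ e == k)%N]%SET [set: 'I_J]%SET.
    by apply/setP => -[i s]; rewrite !inE/= andbT.
  rewrite cardsX cardsT card_ord; congr (_ * _)%N.
  exact: (card_divn_eq KE).
have E0 : (0 < #|E|)%N by rewrite cE muln_gt0 e0.
have G0 : (0 < #|G|)%N by apply/card_gt0P; exists [ffun=> Ordinal D0].
have r'01 : 0 < r' <= 1 by rewrite r'0/= (le_trans r'r).
have [w Hw] := level_set_le (G := G) y1 E0 G0 d0 r'01 m2.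
pose B := (n' * J * #|G|)%N.
pose x' := @refine R d K r x D J n' A w (Ordinal K0) (Ordinal J0) D0.
exists B, r', x'; split.
- split => //.
    by rewrite !muln_gt0 n'0 J0.
  by rewrite /B -mulnA dvdn_mulr.
- by move=> i' a; exact: subc_in (ltW r0).
(* The active cubes have the indices from [k * e] to [k * e + e - 1]; the number [s] encodes such a
   cube together with one of its [J] samples. *)
- exists (e * J)%N.
  exists (fun s => subc (x (k * e + s %/ J)%N) r (w (insubd (Ordinal K0) (k * e + s %/ J)%N, insubd (Ordinal J0) (s %% J)%N))).
  split => //; first by rewrite muln_gt0 e0.
  move=> i' i'K ik; pose i := (i' %/ B)%N; pose b := (i' %% B)%N.
  exists (i %% e * J + b %% J)%N.
    apply: (@leq_trans ((i %% e).+1 * J)); first by rewrite mulSnr ltn_add2l ltn_mod.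
    by rewrite leq_mul2r orbC ltn_mod e0.
  rewrite divnMDl// divn_small ?ltn_mod// addn0 modnMDl modn_mod -ik -divn_eq.
  by rewrite /x' /refine /refine_digit -/B /A ik eqxx.
move=> s j s0 /andP[j2 jm].
have jj : (2 <= j <= m)%N by rewrite j2.
have KJ0 : 0 < (K%:R * J%:R)^-1 :> R by rewrite invr_gt0 mulr_gt0// ltr0n.
have Hj := Hw _ _ _ KJ0 s0 jj.
apply: (le_trans _ (le_trans Hj _)).
  apply: le_lebesgue_d => xi /=.
  have F th := refine_FT r x A w (Ordinal K0) (Ordinal J0) D0 n'0 th xi.
  rewrite /x' /r' /B !F -/r' -/G !normrM -!mulrDr.
  rewrite (ger0_norm (ltW KJ0)) => /le_trans; apply.
  by rewrite ler_wpM2l ?mulr_ge0 ?(ltW KJ0)// lerDr.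
rewrite lee_fin -/C0 cE.
have N1 : 1 <= (e * J)%:R :> R by rewrite ler1n muln_gt0 e0.
set N := (e * J)%:R : R in N1 Jt tJ *.
pose w' := powR r' (d%:R / p).
pose Aa := n%:R^-1 * powR t (- 2^-1) * w'.
have q1 : 1 <= Num.sqrt N by rewrite -[leLHS]sqrtr1 ler_wsqrtr.
have nR : 0 < n%:R :> R by rewrite ltr0n.
have w'0 : 0 < w' by rewrite powR_gt0.
have st0 : 0 < Num.sqrt t by rewrite sqrtr_gt0.
(* With [K = n * e] the left side is [1 / n] times [(e * J) ^ (- 1 / 2)], and [e * J] is about
   [t * r' ^ (- 2 * d / p)]. In [C1] the root of 2 pays for the rounding of [J] and the power of [c]
   for the factor [2 * d ^ 2] in the diameter. *)
have key : (K%:R * J%:R)^-1 * Num.sqrt N <= C1 * Aa.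
  have -> : (K%:R * J%:R)^-1 * Num.sqrt N = n%:R^-1 * (Num.sqrt N)^-1.
    rewrite KE natrM -mulrA -natrM -/N -[N in n%:R * N]sqr_sqrtr; last by lra.
    by field; rewrite !gt_eqF//; lra.
  rewrite /Aa powRN powR12_sqrt ?(ltW t0)//.
  rewrite (_ : C1 * _ = n%:R^-1 * (C1 * w' / Num.sqrt t)); last by ring.
  rewrite ler_pM2l ?invr_gt0// ler_pdivlMr// ler_pdivrMl; last by lra.
  have : t <= (Num.sqrt N * (C1 * w')) ^+ 2.
    rewrite !exprMn sqr_sqrtr; last by lra.
    rewrite sqr_sqrtr// (le_trans tJ)//.
    have -> : powR (2 * d%:R ^+ 2 * (r / D%:R)) (2 * d%:R / p) =
              (powR c (d%:R / p) * w') ^+ 2.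
      rewrite -powRM ?(ltW r'0)//; last by lra.
      rewrite -[RHS]powR_mulrn ?powR_ge0// -powRrM; congr powR; by rewrite [RHS]mulrC mulrA.
    by rewrite exprMn le_eqVlt; apply/orP; left; apply/eqP; ring.
  move=> /ler_wsqrtr; rewrite sqrtr_sqr ger0_norm//.
  exact: mulr_ge0 (le_trans ler01 q1) (mulr_ge0 (le_trans ler01 C11) (ltW w'0)).
have Aa0 : 0 <= Aa by rewrite !mulr_ge0 ?invr_ge0 ?powR_ge0// ltW.
rewrite -/Aa -/w' -/r'.
apply: (@le_trans _ _ (C0 * r' ^- d * (C1 * Aa / s) ^+ j)).
  rewrite ler_wpM2l ?mulr_ge0 ?invr_ge0 ?exprn_ge0 ?(ltW C00) ?(ltW r'0)//.
  apply: lerXn2r; rewrite ?nnegrE ?divr_ge0 ?(ltW s0)//.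
    exact: mulr_ge0 (le_trans ler01 C11) Aa0.
  by rewrite ler_pM2r ?invr_gt0.
have -> : (C1 * Aa / s) ^+ j = C1 ^+ j * (Aa / s) ^+ j by rewrite -[in LHS]mulrA [LHS]exprMn.
rewrite [in leRHS](mulrAC C0) -[leRHS]mulrA.
rewrite ler_wpM2l ?mulr_ge0 ?invr_ge0 ?exprn_ge0 ?(ltW C00) ?(ltW r'0)//.
by rewrite ler_wpM2r ?exprn_ge0 ?divr_ge0 ?(ltW s0)// ler_weXn2l.
Qed.

End step_lemma.

(** * The Lorentz quasi-norm *)

Section kernel.
Context {R : realType}.

(* Unlike [ge0_le_integral], no measurability is required. *)
Lemma le_integral_ge0 d (T : measurableType d) (mu : {measure set T -> \bar R})
    (D : set T) (f g : T -> \bar R) :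
  (forall x, D x -> 0 <= f x)%E -> (forall x, D x -> f x <= g x)%E ->
  (\int[mu]_(x in D) f x <= \int[mu]_(x in D) g x)%E.
Proof.
move=> f0 fg; have g0 x : D x -> (0 <= g x)%E.
  by move=> Dx; exact: le_trans (f0 x Dx) (fg x Dx).
rewrite !ge0_integralE//; apply: le_ereal_sup => _ [h hf <-]; exists h => //= x.
apply: le_trans (hf x) _; rewrite !patchE; case: ifPn => // xD.
by apply: fg; rewrite inE in xD.
Qed.

(** With [Y = a * t ^ b], the product [t * ker a b t] is [Y / (1 + Y) ^ 2]. The total increase
    [1 / b] of the primitive [F] does not depend on [a], so stages of all amplitudes are charged the
    same integral. *)
Let ker (a b t : R) := a * powR t (b - 1) / (1 + a * powR t b) ^+ 2.

Let F (a b : R) : R -> R := fun t => - b^-1 * (1 + a * powR t b)^-1.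

Let den_gt0 (a b t : R) : 0 < a -> 0 < 1 + a * powR t b.
Proof. by move=> a0; rewrite ltr_wpDr// mulr_ge0 ?powR_ge0// ltW. Qed.

Let is_derive_F (a b t : R) : 0 < a -> 0 < b -> 0 < t ->
  is_derive t 1 (F a b) (ker a b t).
Proof.
move=> a0 b0 t0; rewrite /F.
have h1 : is_derive t 1 (fun y => powR y b) (b * powR t (b - 1)) by exact: is_derive1_powR.
have h2 : is_derive t 1 (fun y : R => 1 + a * powR y b) (a * (b * powR t (b - 1))).
  have := is_deriveD (is_derive_cst (1 : R) t 1) (is_deriveZ a h1).
  by rewrite add0r.
have h3 := @is_deriveV R _ t _ _ (lt0r_neq0 (den_gt0 b t a0)) h2.
apply: (is_derive_eq (is_deriveZ (- b^-1) h3)); rewrite /GRing.scale/= /ker; field.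
by rewrite !gt_eqF// den_gt0.
Qed.

Let ker_continuous (a b t : R) : 0 < a -> 0 < b -> 0 < t ->
  {for t, continuous (ker a b)}.
Proof.
move=> a0 b0 t0.
have pc c : {for t, continuous (fun y : R => powR y c)}.
  apply: differentiable_continuous; apply/derivable1_diffP.
  exact: (@ex_derive _ _ _ _ _ _ _ (is_derive1_powR c t0)).
apply: cvgM; first by apply: cvgM; [exact: cvg_cst|exact: pc].
apply: cvgV; first by rewrite expf_neq0// gt_eqF// den_gt0.
have h : {for t, continuous (fun y : R => 1 + a * powR y b)}.
  by apply: cvgD; [exact: cvg_cst|apply: cvgM; [exact: cvg_cst|exact: pc]].
rewrite /continuous_at expr2.
by under eq_fun do rewrite expr2; apply: cvgM; exact: h.
Qed.

Lemma measurable_kernel (a b : R) : 0 < a -> 0 < b ->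
  measurable_fun [set t : R | 0 < t] (ker a b).
Proof.
move=> a0 b0; apply: open_continuous_measurable_fun => //.
by move=> t; rewrite inE/= => t0; exact: ker_continuous.
Qed.

Lemma integral_kernel (a b : R) : 0 < a -> 0 < b ->
  (\int[lebesgue_measure]_(t in [set t : R | (0 < t)%R]) (ker a b t)%:E <= (b^-1)%:E)%E.
Proof.
move=> a0 b0.
(* Starting at [n.+2] keeps every interval nondegenerate, as the fundamental theorem of calculus
   requires. *)
pose I (n : nat) : set R := `[n.+2%:R^-1, n.+2%:R]%classic.
have IE : \bigcup_n I n = [set t : R | 0 < t].
  apply/seteqP; split=> [t [n _]|t]; rewrite /I/= ?in_itv/=.
    by move=> /andP[nt _]; rewrite (lt_le_trans _ nt)// invr_gt0.
  move=> t0; exists (Num.bound t + Num.bound t^-1)%N => //.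
  rewrite /I/= in_itv/=; apply/andP; split.
    rewrite -[leRHS]invrK lef_pV2 ?posrE ?invr_gt0//.
    have := archi_boundP (ltW (_ : 0 < t^-1)); rewrite invr_gt0 => /(_ t0)/ltW/le_trans; apply.
    by rewrite ler_nat -addnS -addnS (leq_trans _ (leq_addl _ _))// -addn2 leq_addr.
  have := archi_boundP (ltW t0) => /ltW/le_trans; apply.
  by rewrite ler_nat -addnS -addnS leq_addr.
have Isub n : I n `<=` [set t : R | 0 < t].
  by rewrite -IE; exact: bigcup_sup.
have In0 n t : I n t -> 0 < t by move=> /Isub.
have H : (\int[lebesgue_measure]_(t in I n) (ker a b t)%:E @[n --> \oo] -->
    \int[lebesgue_measure]_(t in \bigcup_n I n) (ker a b t)%:E)%E.
  apply: ge0_nondecreasing_set_cvg_integral.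
  - apply/nondecreasing_seqP => n; rewrite subsetEset => t; rewrite /I/= !in_itv/=.
    move=> /andP[t1 t2]; apply/andP; split.
      by rewrite (le_trans _ t1)// lef_pV2 ?posrE// ler_nat.
    by rewrite (le_trans t2)// ler_nat.
  - by move=> n; exact: measurable_itv.
  - move=> n; apply/measurable_EFinP; apply: (measurable_funS _ (@Isub n)); last exact: measurable_kernel.
    by rewrite -IE; apply: bigcup_measurable => *; exact: measurable_itv.
  - move=> n t /In0 t0; rewrite lee_fin divr_ge0 ?sqr_ge0// mulr_ge0 ?powR_ge0//.
    exact: ltW.
rewrite -IE -(cvg_lim _ H)//; apply: lime_le; first by apply/cvg_ex; exists (\int[lebesgue_measure]_(t in \bigcup_n I n) (ker a b t)%:E)%E.
apply: nearW => n.
  rewrite (@continuous_FTC2 R (ker a b) (F a b))//.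
  + rewrite /F -EFinB lee_fin !mulNr opprK addrC -mulrBr ler_piMr// ?invr_ge0 ?(ltW b0)//.
    rewrite lerBlDr (@le_trans _ _ 1)//.
      by rewrite invf_le1 ?den_gt0// lerDl mulr_ge0 ?powR_ge0// ltW.
    by rewrite lerDl invr_ge0 ltW// den_gt0.
  + by rewrite (@lt_trans _ _ 1)// ?invf_lt1 ?ltr1n.
  + apply: continuous_in_subspaceT => t; rewrite inE => /(In0 n) t0.
    exact: ker_continuous.
  + have Fc t : 0 < t -> {for t, continuous (F a b)}.
      move=> t0; apply: differentiable_continuous; apply/derivable1_diffP.
      exact: (@ex_derive _ _ _ _ _ _ _ (is_derive_F a0 b0 t0)).
    split.
    * move=> t; rewrite in_itv/= => /andP[nt _].
      have t0 : 0 < t by rewrite (lt_trans _ nt)// invr_gt0.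
      exact: (@ex_derive _ _ _ _ _ _ _ (is_derive_F a0 b0 t0)).
    * by apply: cvg_at_right_filter; apply: Fc; rewrite invr_gt0.
    * by apply: cvg_at_left_filter; apply: Fc.
  + move=> t; rewrite in_itv/= => /andP[nt _].
    have t0 : 0 < t by rewrite (lt_trans _ nt)// invr_gt0.
    by rewrite derive1E; exact: (@derive_val _ _ _ _ _ _ _ (is_derive_F a0 b0 t0)).
Qed.

End kernel.

Section weight.
Context {R : realType}.
Implicit Types Y x : R.

Let pow1R (e : R) : powR 1 e = 1. Proof. by rewrite powR1. Qed.

(* [wgt Y] is [Y] times the derivative of [Y / (1 + Y)], hence telescopes along
   lacunary sequences and integrates against [dt / t]. *)
Definition wgt Y : R := Y / (1 + Y) ^+ 2.

Lemma wgt_gt0 Y : 0 < Y -> 0 < wgt Y.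
Proof. by move=> Y0; rewrite divr_gt0// exprn_gt0//; lra. Qed.

(** Along a sequence growing at least by the factor [z], the weights therefore sum to at most
    [z / (z - 1)], since [Y / (1 + Y)] stays between 0 and 1. *)
Lemma wgt_telescope (z Y Y' : R) : 1 < z -> 0 < Y -> z * Y <= Y' ->
  wgt Y <= z / (z - 1) * (Y' / (1 + Y') - Y / (1 + Y)).
Proof.
move=> z1 Y0 YY; have Y'0 : 0 < Y' by nra.
have -> : wgt Y = z / (z - 1) * ((z - 1) * Y / (z * (1 + Y) * (1 + Y))).
  by rewrite /wgt; field; rewrite !gt_eqF//; lra.
rewrite ler_pM2l ?divr_gt0//; try lra.
have -> : Y' / (1 + Y') - Y / (1 + Y) = (Y' - Y) / ((1 + Y') * (1 + Y)).
  by field; rewrite !gt_eqF//; lra.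
rewrite ler_pdivrMr ?mulr_gt0//; try lra.
rewrite mulrAC ler_pdivlMr ?mulr_gt0//; try lra.
have h1 : 0 <= (Y' - z * Y) * (z + Y) by rewrite mulr_ge0//; lra.
have h2 : 0 <= (z - 1) ^+ 2 * Y by rewrite mulr_ge0 ?sqr_ge0// ltW.
have -> : (Y' - Y) * (z * (1 + Y) * (1 + Y)) = (z - 1) * Y * ((1 + Y') * (1 + Y)) +
  ((Y' - z * Y) * (z + Y) + (z - 1) ^+ 2 * Y) * (1 + Y) by ring.
by rewrite lerDl mulr_ge0 ?addr_ge0//; lra.
Qed.

Lemma wgt_leV Y : 0 < Y -> wgt Y <= Y^-1.
Proof.
move=> Y0; rewrite /wgt ler_pdivrMr ?exprn_gt0//; last lra.
by rewrite ler_pdivlMl//; nra.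
Qed.

Lemma wgt_le Y : 0 < Y -> wgt Y <= Y.
Proof. by move=> Y0; rewrite /wgt ler_pdivrMr ?exprn_gt0//; nra. Qed.

Lemma wgt_le1 Y : 0 < Y -> wgt Y <= 1.
Proof. by move=> Y0; rewrite /wgt ler_pdivrMr ?exprn_gt0//; nra. Qed.

Lemma wgt_geV Y : 1 <= Y -> Y^-1 / 4 <= wgt Y.
Proof.
move=> Y1; rewrite /wgt ler_pdivlMr ?exprn_gt0//; last lra.
have Y0 : 0 < Y by lra.
by rewrite -mulrA ler_pdivrMl//; nra.
Qed.

Lemma wgt_ge Y : 0 < Y <= 1 -> Y / 4 <= wgt Y.
Proof.
by move=> /andP[Y0 Y1]; rewrite /wgt ler_pdivlMr ?exprn_gt0//; [nra|lra].
Qed.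

(** Up to constants [wgt Y] is the smaller of [Y] and [Y^-1], an expression that commutes with
    powers. *)
Lemma wgt_powR (Y e : R) : 0 < Y -> 0 <= e -> powR (wgt Y) e <= 4 * wgt (powR Y e).
Proof.
move=> Y0 e0; have w0 := ltW (wgt_gt0 Y0).
have Ye0 : 0 < powR Y e by rewrite powR_gt0.
have [Y1|Y1] := leP Y 1.
  apply: (@le_trans _ _ (powR Y e)).
    by rewrite ge0_ler_powR ?nnegrE ?(ltW Y0)// wgt_le.
  have : powR Y e <= 1 by rewrite -(pow1R e) ge0_ler_powR ?nnegrE ?(ltW Y0).
  by move=> Ye1; have := @wgt_ge (powR Y e); rewrite Ye0 Ye1 => /(_ isT); lra.
apply: (@le_trans _ _ (powR Y^-1 e)).
  by rewrite ge0_ler_powR ?nnegrE ?invr_ge0 ?(ltW Y0)// wgt_leV.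
have -> : powR Y^-1 e = (powR Y e)^-1.
  by rewrite -powR_inv1 ?(ltW Y0)// -powRrM mulN1r powRN.
have : 1 <= powR Y e by rewrite -[leLHS](pow1R e) ge0_ler_powR ?nnegrE ?(ltW Y0)// ltW.
by move=> /wgt_geV; lra.
Qed.

(** Here [x] is a level relative to the amplitude of one step. For [x >= 1] the large exponent [m]
    beats [x ^ p]; for [x < 1] the exponent 2 leaves a positive power of [x], as [2 < p]. The
    conditions on [eta] and [m] leave just enough room for the share of the level and for two
    factors [wgt]. *)
Lemma wgt_level (p eta k : R) (m : nat) x : 0 < eta -> eta <= 1 / 2 ->
  eta <= (p - 2) / 4 -> 1 <= k -> 2 * p + 2 <= m%:R -> (2 <= m)%N -> 0 < x ->
  exists2 i, (2 <= i <= m)%N &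
  powR x p / (wgt (powR x eta) / (2 * k) * x) ^+ i <=
  16 * (8 * k) ^+ m * wgt (powR x eta) ^+ 2.
Proof.
move=> eta0 eta1 etap k1 pm m2 x0.
set Y := powR x eta.
have Y0 : 0 < Y by rewrite powR_gt0.
have w0 := wgt_gt0 Y0.
have k80 : 0 < 8 * k by lra.
have [x1|x1] := leP 1 x.
  exists m; first by rewrite m2/=.
  have Y1 : 1 <= Y by rewrite -[leLHS](powRr0 x) ler_powR// ltW.
  have wY := wgt_geV Y1.
  have u : powR x (1 - eta) / (8 * k) <= wgt Y / (2 * k) * x.
    rewrite powRB; last by apply/implyP => _; rewrite gt_eqF.
    rewrite powRr1 ?(ltW x0)// -/Y.
    have -> : x / Y / (8 * k) = Y^-1 / 4 * (x / (2 * k)) by field; rewrite !gt_eqF//; lra.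
    rewrite [leRHS](_ : _ = wgt Y * (x / (2 * k))); last by ring.
    by rewrite ler_pM2r// divr_gt0//; lra.
  have u0 : 0 < powR x (1 - eta) / (8 * k) by rewrite divr_gt0// powR_gt0.
  apply: (@le_trans _ _ (powR x p / (powR x (1 - eta) / (8 * k)) ^+ m)).
    rewrite ler_wpM2l ?powR_ge0// lef_pV2 ?posrE ?exprn_gt0//.
      by rewrite lerXn2r ?nnegrE ?(ltW u0)// (le_trans (ltW u0)).
    exact: lt_le_trans u.
  rewrite expr_div_n invf_div mulrCA.
  rewrite [leRHS](_ : _ = (8 * k) ^+ m * (16 * wgt Y ^+ 2)); last by ring.
  rewrite ler_wpM2l ?exprn_ge0 ?(ltW k80)//.
  have -> : powR x (1 - eta) ^+ m = powR x ((1 - eta) * m%:R).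
    by rewrite -powR_mulrn ?powR_ge0// -powRrM.
  rewrite -powRB; last by apply/implyP => _; rewrite gt_eqF.
  apply: (@le_trans _ _ (powR x (- (2 * eta)))).
    by rewrite ler_powR//; nra.
  have -> : powR x (- (2 * eta)) = Y^-1 ^+ 2.
    by rewrite powRN exprVn /Y -powR_mulrn ?powR_ge0// -powRrM mulrC.
  have : 0 < Y^-1 by rewrite invr_gt0.
  by nra.
exists 2%N; first by [].
have Y1 : Y <= 1 by rewrite -[leRHS](pow1R eta) ge0_ler_powR ?nnegrE ?(ltW x0) ?(ltW eta0)// ltW.
have wY : Y / 4 <= wgt Y by apply: wgt_ge; rewrite Y0.
have u : powR x (1 + eta) / (8 * k) <= wgt Y / (2 * k) * x.
  rewrite powRD; last by apply/implyP => _; rewrite gt_eqF.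
  rewrite powRr1 ?(ltW x0)// -/Y.
  have -> : x * Y / (8 * k) = Y / 4 * (x / (2 * k)) by field; rewrite !gt_eqF//; lra.
  rewrite [leRHS](_ : _ = wgt Y * (x / (2 * k))); last by ring.
  by rewrite ler_pM2r// divr_gt0//; lra.
have u0 : 0 < powR x (1 + eta) / (8 * k) by rewrite divr_gt0// powR_gt0.
apply: (@le_trans _ _ (powR x p / (powR x (1 + eta) / (8 * k)) ^+ 2)).
  rewrite ler_wpM2l ?powR_ge0// lef_pV2 ?posrE ?exprn_gt0//.
    by rewrite lerXn2r ?nnegrE ?(ltW u0)// (le_trans (ltW u0)).
  exact: lt_le_trans u.
rewrite expr_div_n invf_div.
have -> : powR x (1 + eta) ^+ 2 = powR x ((1 + eta) * 2%:R).
  by rewrite -powR_mulrn ?powR_ge0// -powRrM.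
rewrite mulrCA -powRB; last by apply/implyP => _; rewrite gt_eqF.
have h1 : powR x (p - (1 + eta) * 2%:R) <= Y ^+ 2.
  have -> : Y ^+ 2 = powR x (2 * eta).
    by rewrite /Y -powR_mulrn ?powR_ge0// -powRrM mulrC.
  have -> : p - (1 + eta) * 2%:R = 2 * eta + (p - 2 - 4 * eta) by ring.
  rewrite powRD; last by apply/implyP => _; rewrite gt_eqF.
  rewrite ler_piMr ?powR_ge0//.
  rewrite -[leRHS](pow1R (p - 2 - 4 * eta)) ge0_ler_powR ?nnegrE ?(ltW x0)//; last exact: ltW.
  by lra.
have h2 : (8 * k) ^+ 2 <= (8 * k) ^+ m by rewrite ler_weXn2l//; lra.
rewrite [leRHS](_ : _ = (8 * k) ^+ m * (16 * wgt Y ^+ 2)); last by ring.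
rewrite ler_pM ?exprn_ge0 ?powR_ge0 ?(ltW k80)// (le_trans h1)//.
by nra.
Qed.

End weight.

Section lorentz.
Context {R : realType} {d : nat}.
Notation Rd := (d.-tuple R).

Lemma nneseries_le_ub (u : nat -> R) (M : R) :
  (forall j, 0 <= u j) -> (forall J, \sum_(j < J) u j <= M) ->
  (\sum_(0 <= j <oo) (u j)%:E <= M%:E)%E.
Proof.
move=> u0 uM; apply: lime_le.
  by apply: is_cvg_nneseries => j _ _; rewrite lee_fin.
by apply: nearW => J; rewrite sumEFin lee_fin big_mkord.
Qed.

(* If [t <= `|f xi|] then some [H j xi] exceeds the share
   [wgt ((t / A j) `^ eta) / (2 k)] of [t], since these shares add up to at most
   [1 / 2]. *)
Lemma in_Lorentz_sum (p q C Q : R) (m : nat) (f : Rd -> R) (H : nat -> Rd -> R)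
    (A c : nat -> R) :
  2 < p -> 1 < q -> 2 * p + 2 <= m%:R -> 0 <= C ->
  (forall j, 0 < A j) -> (forall j, 2 * A j.+1 <= A j) -> (forall j, 0 <= c j) ->
  (forall J, \sum_(j < J) powR (c j) q <= Q) ->
  (forall j (s : R) i, 0 < s -> (2 <= i <= m)%N ->
     (lebesgue_d [set xi | (s <= H j xi)%R] <=
      (C * powR (c j / A j) p * (A j / s) ^+ i)%:E)%E) ->
  (forall xi (b : nat -> R) T, (forall j, H j xi <= b j) ->
     (forall J, \sum_(j < J) b j <= T) -> `|f xi| <= T) ->
  in_Lorentz p q f.
Proof.
move=> p2 q1 pm C0 A0 A2 c0 cQ HL Hf.
have p0 : 0 < p by lra.
have q0 : 0 < q by lra.
have m2 : (2 <= m)%N by rewrite -(ler_nat R); lra.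
pose eta := Num.min (1 / 2) ((p - 2) / 4).
have eta0 : 0 < eta by rewrite lt_min; apply/andP; split; lra.
have eta1 : eta <= 1 / 2 by rewrite ge_min lexx.
have etap : eta <= (p - 2) / 4 by rewrite ge_min lexx orbT.
clearbody eta.
pose z := powR (2 : R) eta.
have z1 : 1 < z.
  have -> : 1 = powR (1 : R) eta by rewrite powR1.
  by rewrite gt0_ltr_powR ?nnegrE//; lra.
pose k := z / (z - 1).
have k1 : 1 <= k by rewrite ler_pdivlMr; lra.
pose Y j (t : R) := powR (t / A j) eta.
have Y0 j t : 0 < t -> 0 < Y j t by move=> t0; rewrite powR_gt0// divr_gt0.
have YS j t : 0 < t -> z * Y j t <= Y j.+1 t.
  move=> t0; rewrite /z /Y -powRM//; last by rewrite divr_ge0// ltW.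
  rewrite ge0_ler_powR ?nnegrE ?(ltW eta0) ?mulr_ge0 ?invr_ge0 ?(ltW t0) ?(ltW (A0 _))//.
  rewrite mulrCA ler_pM2l// -[2]invrK -invfM lef_pV2 ?posrE// ?mulr_gt0 ?invr_gt0//.
  by rewrite ler_pdivlMl.
have sumw t J : 0 < t -> \sum_(j < J) wgt (Y j t) <= k.
  move=> t0; pose G j := Y j t / (1 + Y j t).
  apply: (@le_trans _ _ (\sum_(j < J) k * (G j.+1 - G j))).
    by apply: ler_sum => j _; apply: wgt_telescope => //; [exact: Y0|exact: YS].
  rewrite -mulr_sumr -(big_mkord xpredT (fun j => G j.+1 - G j)) telescope_sumr//.
  rewrite ler_piMr//; first by lra.
  have G1 : G J <= 1 by have YJ := Y0 J t t0; rewrite /G ler_pdivrMr; lra.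
  have G0 : 0 <= G 0%N by have := Y0 0%N t t0; rewrite /G => ?; rewrite divr_ge0//; lra.
  by lra.
pose C1 := C * (16 * (8 * k) ^+ m).
have C10 : 0 <= C1 by rewrite !mulr_ge0 ?exprn_ge0//; lra.
pose e j (t : R) := C1 * powR (c j) p * wgt (Y j t) ^+ 2 / powR t p.
have He j t : 0 < t ->
    (lebesgue_d [set xi | (t * (wgt (Y j t) / (2 * k)) <= H j xi)%R] <= (e j t)%:E)%E.
  move=> t0; have w0 : 0 < wgt (Y j t) / (2 * k).
    by rewrite divr_gt0 ?wgt_gt0 ?Y0//; lra.
  have x0 : 0 < t / A j by rewrite divr_gt0.
  have [i im key] := wgt_level eta0 eta1 etap k1 pm m2 x0.
  apply: le_trans (HL j _ i _ im) _; first by rewrite mulr_gt0.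
  rewrite lee_fin -/(Y j t) in key *.
  have tp0 : 0 < powR t p by rewrite powR_gt0.
  rewrite /e ler_pdivlMr//.
  have -> : C * powR (c j / A j) p * (A j / (t * (wgt (Y j t) / (2 * k)))) ^+ i * powR t p =
     C * powR (c j) p * (powR (t / A j) p / (wgt (Y j t) / (2 * k) * (t / A j)) ^+ i).
    rewrite !powRM ?invr_ge0 ?(ltW t0) ?(ltW (A0 _))//.
    have -> : A j / (t * (wgt (Y j t) / (2 * k))) = (wgt (Y j t) / (2 * k) * (t / A j))^-1.
      by field; rewrite !gt_eqF ?A0 ?wgt_gt0 ?Y0//; lra.
    by rewrite exprVn; ring.
  rewrite /C1 [leRHS](_ : _ = C * powR (c j) p * (16 * (8 * k) ^+ m * wgt (Y j t) ^+ 2)); last by ring.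
  by rewrite ler_wpM2l// mulr_ge0 ?powR_ge0.
have Df t : 0 < t -> (distrib f t <= \sum_(0 <= j <oo) (e j t)%:E)%E.
  move=> t0; pose B j := [set xi | t * (wgt (Y j t) / (2 * k)) <= H j xi].
  apply: (@le_trans _ _ (lebesgue_d (\bigcup_j B j))).
    apply: le_lebesgue_d => xi /= tf; apply: contrapT => nB.
    have Hlt j : H j xi <= t * (wgt (Y j t) / (2 * k)).
      by rewrite leNgt; apply/negP => /ltW ?; apply: nB; exists j.
    have : `|f xi| <= t / 2.
      apply: Hf Hlt _ => J; rewrite -mulr_sumr ler_pM2l// -mulr_suml.
      rewrite ler_pdivrMr; last lra.
      by have := sumw t J t0; lra.
    by lra.
  apply: le_trans (lebesgue_d_sigma_subadditive _) _.
  apply: lee_nneseries => j _ *; last exact: He.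
  exact: lebesgue_d_ge0.
pose qp := q / p.
have qp0 : 0 < qp by rewrite divr_gt0.
have pqp : p * qp = q by rewrite mulrCA divff ?mulr1// gt_eqF.
pose be := eta * qp.
have be0 : 0 < be by rewrite mulr_gt0.
pose a j := powR (A j) (- be).
have a0 j : 0 < a j by rewrite powR_gt0.
pose ker j t := a j * powR t (be - 1) / (1 + a j * powR t be) ^+ 2.
have ker0 j t : 0 <= ker j t.
  by rewrite divr_ge0 ?sqr_ge0// mulr_ge0 ?powR_ge0// ltW.
pose M := 4 * powR (k * C1) qp.
have M0 : 0 <= M by rewrite mulr_ge0 ?powR_ge0.
have wker j t : 0 < t -> powR (wgt (Y j t)) qp <= 4 * (t * ker j t).
  move=> t0; apply: le_trans (wgt_powR (Y0 j t t0) (ltW qp0)) _.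
  rewrite ler_pM2l// /Y -powRrM -/be.
  have -> : powR (t / A j) be = a j * powR t be.
    rewrite powRM ?invr_ge0 ?(ltW t0) ?(ltW (A0 _))// mulrC /a powRN; congr (_ * _).
    by rewrite -[X in powR X _]powR_inv1 ?(ltW (A0 _))// -powRrM mulN1r powRN.
  rewrite /ker /wgt powRB; last by apply/implyP => _; rewrite gt_eqF.
  rewrite powRr1 ?(ltW t0)// le_eqVlt; apply/orP; left; apply/eqP; field.
  by rewrite !gt_eqF//; have := powR_ge0 t be; have := a0 j; nra.
(* The argument is the same for [q / p] below and above 1. Of the two factors [wgt] in [e j t], one
   sums to at most [k]. The other stays in the terms [C1 * c j ^ p * wgt], all bounded by [g], and
   [g ^ (q / p)] is the sum [S] of the [q / p]-th powers of these terms. *)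
have main t : 0 < t ->
   (poweR (distrib f t * (powR t p)%:E) (q / p) * (t^-1)%:E <=
    \sum_(0 <= j <oo) (M * powR (c j) q * ker j t)%:E)%E.
  move=> t0; have tp0 : 0 < powR t p by rewrite powR_gt0.
  pose s j := powR C1 qp * powR (c j) q * powR (wgt (Y j t)) qp.
  have s0 j : 0 <= s j by rewrite !mulr_ge0 ?powR_ge0.
  have sE j : powR (C1 * powR (c j) p * wgt (Y j t)) qp = s j.
    have w0 := ltW (wgt_gt0 (Y0 j t t0)); have cp0 := powR_ge0 (c j) p.
    by rewrite (powRM qp (mulr_ge0 C10 cp0) w0) (powRM qp C10 cp0) -powRrM pqp.
  have sQ J : \sum_(j < J) s j <= powR C1 qp * Q.
    apply: (@le_trans _ _ (powR C1 qp * \sum_(j < J) powR (c j) q)); last first.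
      by rewrite ler_wpM2l ?powR_ge0.
    rewrite mulr_sumr; apply: ler_sum => j _; rewrite ler_piMr ?mulr_ge0 ?powR_ge0//.
    have -> : 1 = powR (1 : R) qp by rewrite powR1.
    by rewrite ge0_ler_powR ?nnegrE ?(ltW qp0) ?(ltW (wgt_gt0 (Y0 j t t0)))// wgt_le1// Y0.
  have Sfin : (\sum_(0 <= j <oo) (s j)%:E)%E \is a fin_num.
    rewrite ge0_fin_numE ?nneseries_ge0//; last by move=> *; rewrite lee_fin.
    by apply: le_lt_trans (nneseries_le_ub s0 sQ) _; rewrite ltry.
  pose S := fine (\sum_(0 <= j <oo) (s j)%:E)%E.
  have SE : (\sum_(0 <= j <oo) (s j)%:E)%E = S%:E by rewrite fineK.
  have sS j : s j <= S.
    rewrite -lee_fin -SE; apply: le_trans (nneseries_lim_ge j.+1 _); last first.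
      by move=> *; rewrite lee_fin.
    by rewrite big_nat_recr//= leeDr// sumEFin lee_fin sumr_ge0.
  have S0 : 0 <= S by exact: le_trans (s0 0%N) (sS 0%N).
  pose g := powR S qp^-1.
  have g0 : 0 <= g by exact: powR_ge0.
  have cg j : C1 * powR (c j) p * wgt (Y j t) <= g.
    have := sS j; rewrite -sE => /(ge0_ler_powR (r := qp^-1)).
    rewrite invr_ge0 (ltW qp0) !nnegrE powR_ge0 S0 => /(_ isT isT isT).
    rewrite -powRrM divff ?gt_eqF// powRr1//.
    by rewrite mulr_ge0 ?(ltW (wgt_gt0 (Y0 j t t0)))// mulr_ge0 ?powR_ge0.
  have Dg : (distrib f t * (powR t p)%:E <= (k * g)%:E)%E.
    rewrite -lee_pdivlMr// -EFinM.
    apply: le_trans (Df t t0) _; apply: nneseries_le_ub => [j|J].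
      by rewrite divr_ge0 ?powR_ge0// mulr_ge0 ?sqr_ge0// mulr_ge0 ?powR_ge0.
    rewrite -mulr_suml ler_pM2r ?invr_gt0//.
    apply: (@le_trans _ _ (\sum_(j < J) wgt (Y j t) * g)).
      apply: ler_sum => j _; rewrite expr2 mulrA mulrC ler_wpM2l//.
      exact: ltW (wgt_gt0 (Y0 j t t0)).
    by rewrite -mulr_suml ler_wpM2r// sumw.
  have D0 : (0 <= distrib f t * (powR t p)%:E)%E.
    by rewrite mule_ge0 ?lebesgue_d_ge0// lee_fin ltW.
  have kg0 : 0 <= k * g by rewrite mulr_ge0//; lra.
  apply: (@le_trans _ _ (\sum_(0 <= j <oo) (powR k qp / t)%:E * (s j)%:E)%E); last first.
    apply: lee_nneseries => j _ *.
      by rewrite -EFinM lee_fin !mulr_ge0 ?invr_ge0 ?powR_ge0 ?(ltW t0).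
    rewrite -EFinM lee_fin /M powRM//; last lra.
    have := wker j t t0 => H1.
    rewrite /s [leLHS](_ : _ = powR k qp * powR C1 qp * powR (c j) q * (powR (wgt (Y j t)) qp / t)); last by ring.
    rewrite [leRHS](_ : _ = powR k qp * powR C1 qp * powR (c j) q * (4 * ker j t)); last by ring.
    rewrite ler_wpM2l ?mulr_ge0 ?powR_ge0// ler_pdivrMr//.
    by rewrite mulrAC -mulrA.
  rewrite nneseriesZl; last by move=> *; rewrite lee_fin.
  have -> : ((powR k qp / t)%:E * (\sum_(0 <= j <oo) (s j)%:E) =
             (powR k qp * S)%:E * (t^-1)%:E)%E by rewrite SE -!EFinM mulrAC.
  apply: lee_wpmul2r; first by rewrite lee_fin invr_ge0 ltW.
  have -> : powR k qp * S = powR (k * g) qp.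
    by rewrite powRM ?powR_ge0//; [rewrite -powRrM mulVf ?powRr1 ?gt_eqF|lra].
  rewrite -[leRHS]poweR_EFin -/qp gt0_ler_poweR ?(ltW qp0)//.
  - by rewrite in_itv/= D0 leey.
  - by rewrite in_itv/= lee_fin kg0 leey.
have mpos : measurable [set t : R | 0 < t] by apply: open_measurable; exact: open_gt.
rewrite /in_Lorentz /lorentz_normq.
apply: (@le_lt_trans _ _ (q%:E * (M / be * Q)%:E)%E); last by rewrite -EFinM ltry.
rewrite lee_pmul2l//.
apply: (@le_trans _ _ (\int[lebesgue_measure]_(t in [set t : R | (0 < t)%R])
    (\sum_(0 <= j <oo) (M * powR (c j) q * ker j t)%:E))%E).
  apply: le_integral_ge0 => t /= t0; last exact: main.
  by rewrite mule_ge0 ?poweR_ge0// lee_fin invr_ge0 ltW.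
rewrite integral_nneseries//=; last 2 first.
- move=> j; apply/measurable_EFinP; apply: measurable_funM => //.
  exact: measurable_kernel.
- by move=> j t _; rewrite lee_fin; exact: mulr_ge0 (mulr_ge0 M0 (powR_ge0 _ _)) (ker0 j t).
apply: (@le_trans _ _ (\sum_(0 <= j <oo) (M / be * powR (c j) q)%:E)%E).
  apply: lee_nneseries => j _ *.
    by apply: integral_ge0 => t _; rewrite lee_fin; exact: mulr_ge0 (mulr_ge0 M0 (powR_ge0 _ _)) (ker0 j t).
  under eq_integral do rewrite EFinM.
  rewrite ge0_integralZl_EFin//.
  - apply: (@le_trans _ _ ((M * powR (c j) q)%:E * (be^-1)%:E)%E).
      apply: lee_wpmul2l; first by rewrite lee_fin mulr_ge0 ?powR_ge0.
      exact: integral_kernel.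
    by rewrite -EFinM lee_fin mulrAC.
    - by move=> t _; rewrite lee_fin.
  - by apply/measurable_EFinP; exact: measurable_kernel.
  - by rewrite mulr_ge0 ?powR_ge0.
apply: nneseries_le_ub => [j|J].
  by rewrite !mulr_ge0 ?invr_ge0 ?powR_ge0 ?(ltW be0).
by rewrite -mulr_sumr ler_wpM2l// mulr_ge0 ?invr_ge0 ?(ltW be0).
Qed.

End lorentz.

(** * Parameters of the stages *)

Section blocks.
Variable N : nat -> nat.
Hypothesis N0 : forall g, (0 < N g)%N.

(* Enumerates the pairs [(g, i)] with [i < N g], block after block. *)
Fixpoint blk (j : nat) : nat * nat :=
  if j is j'.+1 then
    let: (g, i) := blk j' in if (i.+1 < N g)%N then (g, i.+1) else (g.+1, 0%N)
  else (0%N, 0%N).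

Definition blk_off g := (\sum_(g' < g) N g')%N.

Lemma blk_offS g : blk_off g.+1 = (blk_off g + N g)%N.
Proof. by rewrite /blk_off big_ord_recr. Qed.

Lemma blkP j : ((blk j).2 < N (blk j).1)%N /\ j = (blk_off (blk j).1 + (blk j).2)%N.
Proof.
elim: j => [|j]/=; first by rewrite /blk_off big_ord0; split; [exact: N0|].
case: (blk j) => g i /= [iN ->]; case: ifPn => /= [h|]; first by rewrite addnS.
rewrite -leqNgt => h; split; first exact: N0.
by rewrite blk_offS addn0 -addnS; congr (_ + _)%N; apply/eqP; rewrite eqn_leq iN.
Qed.

Lemma blk_off_mono g g' : (g < g')%N -> (blk_off g + N g <= blk_off g')%N.
Proof.
elim: g' => // g' IH; rewrite ltnS leq_eqVlt => /predU1P[->|/IH h].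
  by rewrite blk_offS.
by rewrite blk_offS (leq_trans h)// leq_addr.
Qed.

Lemma blk_offK g i : (i < N g)%N -> blk (blk_off g + i) = (g, i).
Proof.
move=> iN; have [] := blkP (blk_off g + i); case: (blk _) => g' i' /= i'N E.
have gg : g = g'.
  apply/eqP; rewrite eqn_leq; apply/andP; split; rewrite leqNgt; apply/negP => /blk_off_mono h.
    have : (blk_off g' + i' < blk_off g + i)%N.
      by rewrite (leq_trans _ (leq_addr _ _))// (leq_trans _ h)// ltn_add2l.
    by rewrite E ltnn.
  have : (blk_off g + i < blk_off g' + i')%N.
    by rewrite (leq_trans _ (leq_addr _ _))// (leq_trans _ h)// ltn_add2l.
  by rewrite E ltnn.
by move/eqP: E; rewrite gg eqn_add2l => /eqP ->.
Qed.

Lemma blk_sum (V : nmodType) (F : nat * nat -> V) J :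
  \sum_(j < blk_off J) F (blk j) = \sum_(g < J) \sum_(i < N g) F (g : nat, i : nat).
Proof.
elim: J => [|J IH]; first by rewrite /blk_off !big_ord0.
rewrite blk_offS big_split_ord/= IH big_ord_recr/=; congr (_ + _).
by apply: eq_bigr => i _; rewrite blk_offK.
Qed.

Lemma leq_blk_off g : (g <= blk_off g)%N.
Proof. by elim: g => // g IH; rewrite blk_offS -addn1 leq_add. Qed.

End blocks.

Section parameters.
Context {R : realType}.

(* With [M = n t^(q'/2)] the third quantity is [M^(1 - q)]; then [t] is taken so
   small that [Phi t] is negligible against [t^(q'/2) / M]. *)
Lemma stage_params (q : R) (Phi : R -> R) (e : R) : 1 < q ->
  (forall x, 0 <= x -> 0 <= Phi x) ->
  (fun t => Phi t / powR t ((q / (q - 1)) / 2)) x @[x --> 0^'+] --> (0 : R) ->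
  0 < e ->
  exists (n : nat) (t : R), [/\ (0 < n)%N, 0 < t,
    n%:R * powR (n%:R^-1 * powR t (- 2^-1)) q <= e & n%:R * Phi t <= e].
Proof.
move=> q1 P0 Pl e0; set gm := q / (q - 1) / 2 in Pl *.
have gm0 : 0 < gm by rewrite !divr_gt0//; lra.
(* Solves [M ^ (1 - q) = e]. *)
pose M := powR e (- (q - 1)^-1).
have M0 : 0 < M by rewrite powR_gt0.
have [t [t0 t1 Pt]] : exists t, [/\ 0 < t, t <= 1 & Phi t <= e / (M + 1) * powR t gm].
  have e'0 : 0 < e / (M + 1) by rewrite divr_gt0//; lra.
  have /cvgrPdist_lt/(_ _ e'0) Pn := Pl.
  have : \forall t \near (0 : R)^'+, [/\ 0 < t, t <= 1 & Phi t <= e / (M + 1) * powR t gm].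
    near=> t.
    have t0 : 0 < t by near: t; exact: nbhs_right_gt.
    split => //; first by near: t; apply: nbhs_right_le.
    have : `|0 - Phi t / powR t gm| < e / (M + 1) by near: t.
    rewrite sub0r normrN ltr_norml => /andP[_ /ltW].
    by rewrite ler_pdivrMr ?powR_gt0.
  by move=> /(@filter_ex _ _ _) [t]; exists t.
pose u := powR t gm.
have u0 : 0 < u by rewrite powR_gt0.
have u1 : u <= 1.
  have -> : 1 = powR (1 : R) gm by rewrite powR1.
  by rewrite ge0_ler_powR ?nnegrE ?(ltW gm0) ?(ltW t0).
(* Thus [n * u] lies between [M] and [M + u], where [u <= 1]: the lower bound serves the first
   estimate, the upper one the cost of the cover. *)
pose n := (Num.trunc (M / u)).+1.
have Mu : 0 <= M / u by rewrite divr_ge0 ?ltW.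
have /andP[n1 n2] := truncn_itv Mu; rewrite -/n in n2.
have {}n1 : n%:R <= M / u + 1 by rewrite /n -natr1; lra.
have nR : 0 < n%:R :> R by rewrite ltr0n.
exists n, t; split => //.
  have -> : n%:R * powR (n%:R^-1 * powR t (- 2^-1)) q = powR (n%:R * u) (1 - q).
    rewrite !powRM ?invr_ge0 ?powR_ge0 ?(ltW nR) ?(ltW u0)//.
    rewrite -!powRrM mulrA.
    have -> : gm * (1 - q) = - 2^-1 * q.
      by rewrite /gm; field; rewrite !gt_eqF//; lra.
    congr (_ * _); rewrite -powR_inv1 ?(ltW nR)// -powRrM.
    rewrite -[X in X * _ = _]powRr1 ?(ltW nR)// -powRD; last by apply/implyP => _; rewrite gt_eqF.
    by rewrite mulN1r.
  have -> : e = powR M (1 - q).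
    rewrite /M -powRrM (_ : - (q - 1)^-1 * (1 - q) = 1) ?powRr1 ?(ltW e0)//.
    by field; rewrite gt_eqF//; lra.
  have -> : 1 - q = - (q - 1) by ring.
  rewrite !powRN lef_pV2 ?posrE ?powR_gt0 ?mulr_gt0//.
  rewrite ge0_ler_powR ?nnegrE ?(ltW M0) ?mulr_ge0 ?(ltW u0)//; first lra.
  by rewrite -ler_pdivrMr// ltW.
apply: (@le_trans _ _ ((M / u + 1) * (e / (M + 1) * u))).
  by apply: ler_pM => //; exact/P0/ltW.
rewrite (_ : _ * _ = e * ((M + u) / (M + 1))); last by field; rewrite !gt_eqF//; lra.
by rewrite ler_piMr ?(ltW e0)// ler_pdivrMr; lra.
Unshelve. all: by end_near. Qed.

(** Stage [g] gets the tolerance [2 ^- g.+1] and is spread over [n] consecutive indices, one for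
    each fraction of the mass. The last clause provides complete runs through all fractions
    arbitrarily late, which is what covers every point of the limit set by small cubes. *)
Lemma stage_sequence (q : R) (Phi : R -> R) : 1 < q ->
  (forall x, 0 <= x -> 0 <= Phi x) ->
  (fun t => Phi t / powR t ((q / (q - 1)) / 2)) x @[x --> 0^'+] --> (0 : R) ->
  exists (n k : nat -> nat) (t : nat -> R),
    [/\ (forall j, (k j < n j)%N), (forall j, 0 < t j),
        (forall J, \sum_(j < J) powR ((n j)%:R^-1 * powR (t j) (- 2^-1)) q <= 1),
        (forall J, \sum_(j < J) Phi (t j) <= 1) &
        forall j0, exists2 j1, (j0 <= j1)%N &
          forall i, (i < n j1)%N -> n (j1 + i)%N = n j1 /\ k (j1 + i)%N = i].
Proof.
move=> q1 P0 Pl.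
have e0 (g : nat) : 0 < (2 ^+ g.+1)^-1 :> R by rewrite invr_gt0 exprn_gt0.
have H g : exists nt : nat * R, [/\ (0 < nt.1)%N, 0 < nt.2,
    nt.1%:R * powR (nt.1%:R^-1 * powR nt.2 (- 2^-1)) q <= (2 ^+ g.+1)^-1 &
    nt.1%:R * Phi nt.2 <= (2 ^+ g.+1)^-1].
  by have [n [t ?]] := stage_params q1 P0 Pl (e0 g); exists (n, t).
have [nt Hnt] := choice H.
pose N g := (nt g).1.
have N0 g : (0 < N g)%N by have [] := Hnt g.
have geo J : \sum_(g < J) (2 ^+ g.+1)^-1 <= 1 :> R.
  suff -> : \sum_(g < J) (2 ^+ g.+1)^-1 = 1 - (2 ^+ J)^-1 :> R.
    by rewrite gerBl invr_ge0 exprn_ge0.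
  elim: J => [|J IH]; first by rewrite big_ord0 expr0 invr1 subrr.
  by rewrite big_ord_recr/= IH exprS; field; rewrite expf_neq0.
have bnd (F : nat -> R) : (forall g, 0 <= F g) ->
    (forall g, (N g)%:R * F g <= (2 ^+ g.+1)^-1) ->
    forall J, \sum_(j < J) F (blk N j).1 <= 1.
  move=> F0 FN J; apply: (@le_trans _ _ (\sum_(j < blk_off N J) F (blk N j).1)).
    rewrite -(subnKC (leq_blk_off N0 J)) big_split_ord/= lerDl.
    by apply: sumr_ge0.
  rewrite (blk_sum N0 (fun gi => F gi.1)) (le_trans _ (geo J))//.
  by apply: ler_sum => g _; rewrite /= sumr_const card_ord -[leLHS]mulr_natl.
exists (fun j => N (blk N j).1), (fun j => (blk N j).2), (fun j => (nt (blk N j).1).2).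
split.
- by move=> j; have [] := blkP N0 j.
- by move=> j; have [] := Hnt (blk N j).1.
- apply: (bnd (fun g => powR ((N g)%:R^-1 * powR (nt g).2 (- 2^-1)) q)).
    by move=> g; exact: powR_ge0.
  by move=> g; have [] := Hnt g.
- apply: (bnd (fun g => Phi (nt g).2)).
    by move=> g; apply: P0; have [_ /ltW] := Hnt g.
  by move=> g; have [] := Hnt g.
- move=> j0; exists (blk_off N j0); first exact: leq_blk_off.
  have E0 : blk N (blk_off N j0) = (j0, 0%N).
    by rewrite -[blk_off _ _]addn0 blk_offK.
  by move=> i; rewrite E0/= => iN; rewrite blk_offK.
Qed.

End parameters.

(** * Coverings *)

Section covering.
Context {R : realType} {d : nat}.
Notation Rd := (d.-tuple R).
Implicit Types x y c : Rd.

Lemma coord_le_edist x y i : `|tnth x i - tnth y i| <= edist x y.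
Proof.
rewrite -sqrtr_sqr ler_wsqrtr// (bigD1 i)//= lerDl.
by apply: sumr_ge0 => j _; exact: sqr_ge0.
Qed.

Lemma edist_le_sum x y : edist x y <= \sum_(i < d) `|tnth x i - tnth y i|.
Proof.
have s0 : 0 <= \sum_(i < d) `|tnth x i - tnth y i| by apply: sumr_ge0.
rewrite -[leRHS]ger0_norm// -sqrtr_sqr ler_wsqrtr// [leRHS]expr2 mulr_suml.
apply: ler_sum => i _; rewrite -[leLHS]ger0_norm ?sqr_ge0// expr2 normrM ler_wpM2l//.
by rewrite (bigD1 i)//= lerDl sumr_ge0.
Qed.

Lemma cube_sub_cball x y r : (forall i, `|tnth x i - tnth y i| <= r) ->
  cball x (d%:R * r) y.
Proof.
move=> xyr; rewrite /cball/= (le_trans (edist_le_sum x y))//.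
by rewrite -[X in X%:R](card_ord d) [leRHS]mulr_natl -sumr_const ler_sum.
Qed.

Lemma diam_cball_transl c c' r : (diam (cball c r) <= diam (cball c' r))%E.
Proof.
pose T x : Rd := [tuple tnth x i - tnth c i + tnth c' i | i < d].
have eT x y : edist (T x) (T y) = edist x y.
  by congr Num.sqrt; apply: eq_bigr => i _; rewrite !tnth_mktuple; congr (_ ^+ 2); ring.
have Tc : T c = c' by apply: eq_from_tnth => i; rewrite tnth_mktuple subrr add0r.
apply: ge_ereal_sup => _ [x xc [y yc <-]]; rewrite -eT.
apply: ereal_sup_ubound; exists (T x); first by rewrite /cball/= -Tc eT.
by exists (T y) => //; rewrite /cball/= -Tc eT.
Qed.

(** All balls of one radius share one diameter, hence one dyadic class; the two bounds on it serve
    to separate the classes of different radii. *)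
Lemma diam_cball r : (0 < d)%N -> 0 < r ->
  exists2 tau : R, r <= tau <= 2 * d%:R * r & forall c, diam (cball c r) = tau%:E.
Proof.
move=> d0 r0; pose o : Rd := [tuple 0 | i < d].
have lo : (r%:E <= diam (cball o r))%E.
  pose e : Rd := [tuple if i == Ordinal d0 then r else 0 | i < d].
  have oe : edist o e = r.
    rewrite /edist (bigD1 (Ordinal d0))//= !tnth_mktuple eqxx sub0r sqrrN big1 ?addr0.
      by rewrite sqrtr_sqr ger0_norm// ltW.
    by move=> i /negbTE i0; rewrite !tnth_mktuple i0 subrr expr0n.
  have oo : edist o o = 0.
    by rewrite /edist big1 ?sqrtr0// => i _; rewrite subrr expr0n.
  apply: ereal_sup_ubound; exists o; first by rewrite /cball/= oo ltW.
  by exists e; rewrite /cball/= ?oe.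
have hi : (diam (cball o r) <= (2 * d%:R * r)%:E)%E.
  apply: ge_ereal_sup => _ [x xo [y yo <-]]; rewrite lee_fin.
  rewrite (le_trans (edist_le_sum x y))//.
  rewrite mulrAC mulr_natr -[X in _ *+ X](card_ord d) -sumr_const ler_sum// => i _.
  have h1 := le_trans (coord_le_edist o x i) xo.
  have h2 := le_trans (coord_le_edist o y i) yo.
  have -> : tnth x i - tnth y i = (tnth o i - tnth y i) - (tnth o i - tnth x i) by ring.
  by rewrite (le_trans (ler_normB _ _))//; lra.
have fin : diam (cball o r) \is a fin_num.
  by rewrite fin_numE; apply/andP; split; apply/eqP => h; move: lo hi; rewrite h.
exists (fine (diam (cball o r))); first by rewrite -!lee_fin fineK// lo hi.
move=> c; rewrite fineK//; apply/eqP; rewrite eq_le.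
by rewrite !diam_cball_transl.
Qed.

Lemma in_Delta_inj (k k' : int) (x : R) : in_Delta k x%:E -> in_Delta k' x%:E -> k = k'.
Proof.
wlog kk : k k' / (k < k')%R.
  move=> H h1 h2; case: (ltgtP k k') => // h; first exact: H h h1 h2.
  by apply/esym; exact: H h h2 h1.
rewrite /in_Delta !lee_fin !lte_fin => /andP[h1 _] /andP[_ h2]; exfalso.
have : (2 : R) ^ (- k') <= 2 ^ (- k - 1).
  by apply: ler_weXz2l; [rewrite ler1n|lia].
by move=> h; have := lt_le_trans h2 (le_trans h h1); rewrite ltxx.
Qed.

Lemma in_Delta_ratio (k : int) (x y : R) : 2 * y <= x ->
  in_Delta k x%:E -> in_Delta k y%:E -> False.
Proof.
rewrite /in_Delta !lee_fin !lte_fin => yx /andP[_ h1] /andP[h2 _].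
have E : (2 : R) ^ (- k) = 2 * 2 ^ (- k - 1).
  rewrite -[X in X * _](expr1z (2 : R)) -expfzDr//; congr (_ ^ _); lia.
by move: h1; rewrite E; lra.
Qed.

End covering.

(* Balls of the same group have equal diameters, and the diameters of different
   groups differ by a factor at least 2, so each [Delta_k] meets at most one group. *)
Section HPhi_groups.
Context {R : realType} {d : nat}.
Notation Rd := (d.-tuple R).
Variables (alpha : R) (Phi : R -> R) (t rho : nat -> R) (N : nat -> nat)
  (ctr : nat -> nat -> Rd).
Hypothesis d0 : (0 < d)%N.
Hypothesis alpha0 : 0 < alpha.
Hypothesis Phi_reg : regular Phi.
Hypothesis N0 : forall g, (0 < N g)%N.
Hypothesis rho0 : forall g, 0 < rho g.
Hypothesis rhoS : forall g, 4 * d%:R * rho g.+1 <= rho g.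
Hypothesis Nt : forall g, (N g)%:R * powR (2 * d%:R * rho g) alpha <= t g.

Let t0 g : 0 <= t g.
Proof. by apply: le_trans (Nt g); rewrite mulr_ge0 ?powR_ge0. Qed.

Let Phi_mono x y : 0 <= x -> x <= y -> Phi x <= Phi y.
Proof.
move=> x0 xy; have [_ H _ _ _] := Phi_reg.
by apply: (H x y) => //; rewrite inE/= in_itv/= andbT// (le_trans x0).
Qed.

Let Phi_ge0 x : 0 <= x -> 0 <= Phi x.
Proof. by have [_ _ H _ _] := Phi_reg; exact: H. Qed.

Let Phi0 : Phi 0 = 0.
Proof. by have [_ _ _ H _] := Phi_reg. Qed.

Let rho_lt g g' : (g < g')%N -> 4 * d%:R * rho g' <= rho g.
Proof.
have dR : 1 <= d%:R :> R by rewrite ler1n.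
elim: g' => // g' IH; rewrite ltnS leq_eqVlt => /predU1P[->//|/IH h].
by have := rhoS g'; have := rho0 g'; have := rho0 g'.+1; nra.
Qed.

Let c j := ctr (blk N j).1 (blk N j).2.
Let r j := rho (blk N j).1.

Let tau_ex g : {tau : R | rho g <= tau <= 2 * d%:R * rho g &
   forall x : Rd, diam (cball x (rho g)) = tau%:E}.
Proof. by apply: cid2; exact: diam_cball. Qed.
Let tau g := s2val (tau_ex g).
Let tauP g : rho g <= tau g <= 2 * d%:R * rho g.
Proof. exact: (s2valP (tau_ex g)). Qed.
Let tauE g (x : Rd) : diam (cball x (rho g)) = (tau g)%:E.
Proof. by have H := s2valP' (tau_ex g); exact: H. Qed.
Let tau_gt0 g : 0 < tau g.
Proof. by have /andP[h _] := tauP g; exact: lt_le_trans h. Qed.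

Let diam_j j : diam (cball (c j) (r j)) = (tau (blk N j).1)%:E.
Proof. exact: tauE. Qed.

(** For [g < g'] one has [2 * tau g' <= 4 * d * rho g' <= rho g <= tau g], which explains the ratio
    in [rhoS]. *)
Let same_group g g' (k : int) : in_Delta k (tau g)%:E -> in_Delta k (tau g')%:E -> g = g'.
Proof.
wlog gg : g g' / (g < g')%N.
  move=> H h1 h2; case: (ltngtP g g') => // h; first exact: H h1 h2.
  by apply/esym; exact: H h h2 h1.
move=> h1 h2; exfalso; apply: in_Delta_ratio h1 h2.
have /andP[+ _] := tauP g; have /andP[_ +] := tauP g'; have := rho_lt gg.
by lra.
Qed.

Let mass (k : int) : \bar R := (\esum_(j in [set j | in_Delta k (diam (cball (c j) (r j)))])
  poweR (diam (cball (c j) (r j))) alpha)%E.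

Let mass_empty k : (forall g, ~ in_Delta k (tau g)%:E) -> ephi Phi (mass k) = 0%E.
Proof.
move=> H; rewrite /mass (_ : [set j | _] = set0) ?esum_set0/= ?Phi0//.
by apply/seteqP; split => // j /=; rewrite diam_j => /H.
Qed.

Let mass_le g k : in_Delta k (tau g)%:E -> (ephi Phi (mass k) <= (Phi (t g))%:E)%E.
Proof.
move=> kg.
have mass0 : (0 <= mass k)%E by apply: esum_ge0 => j _; exact: poweR_ge0.
suff mt : (mass k <= (t g)%:E)%E.
  case: (mass k) mass0 mt => [x| |]//=; rewrite !lee_fin => x0 xt.
  exact: Phi_mono.
apply: le_trans (_ : ((N g)%:R * powR (2 * d%:R * rho g) alpha)%:E <= _)%E; last first.
  by rewrite lee_fin Nt.
pose I : set nat := [set (blk_off N g + i)%N | i in `I_(N g)].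
apply: (@le_trans _ _ (\esum_(j in I) (powR (tau g) alpha)%:E)%E).
  rewrite /mass esum_mkcond [leRHS]esum_mkcond; apply: le_esum => j _.
  case: ifPn => [|_]; last by case: ifP => // _; rewrite lee_fin powR_ge0.
  rewrite inE/= diam_j => kj.
  have jg := same_group kg kj.
  have [h1 h2] := blkP N0 j; rewrite -jg in h1 h2.
  by rewrite ifT ?poweR_EFin -?jg// inE; exists (blk N j).2.
rewrite esum_image//; last by move=> i i' _ _ /addnI.
rewrite esum_fset//=; last by move=> *; rewrite lee_fin powR_ge0.
rewrite -fsbig_ord/= sumEFin sumr_const card_ord lee_fin -[leLHS]mulr_natl ler_wpM2l//.
have /andP[_ h] := tauP g.
rewrite ge0_ler_powR ?nnegrE ?(ltW alpha0) ?(ltW (tau_gt0 g))//.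
by rewrite mulr_ge0// ltW.
Qed.

(** A class [k] met by the diameters contains balls of the single group [gam k], and [Phi 0 = 0]
    disposes of the other classes. A diameter lies in one class only, so [gam] is injective there
    and the sum over classes is part of the sum over groups. *)
Lemma cover_value_le :
  (cover_value alpha Phi c r <= \sum_(0 <= g <oo) (Phi (t g))%:E)%E.
Proof.
rewrite /cover_value -/(mass _).
pose D := [set k : int | exists g, in_Delta k (tau g)%:E].
have gam_ex k : exists g, D k -> in_Delta k (tau g)%:E.
  by have [[g h]|h] := pselect (D k); [exists g|exists 0%N].
have [gam Hgam] := choice gam_ex.
apply: (@le_trans _ _ (\esum_(k in D) (Phi (t (gam k)))%:E)%E).
  rewrite [leRHS]esum_mkcond; apply: le_esum => k _; rewrite -/(mass k).
  case: ifPn => [/set_mem Dk|/negP Dk]; first exact/mass_le/Hgam.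
  by rewrite mass_empty// => g h; apply: Dk; apply/mem_set; exists g.
rewrite nneseries_esumT; last by move=> g; rewrite lee_fin Phi_ge0.
rewrite -(esum_image D gam (fun g => (Phi (t g))%:E)); last first.
  move=> k k'; rewrite !inE => /Hgam h /Hgam h' E; rewrite -E in h'.
  exact: in_Delta_inj h h'.
rewrite esum_mkcond; apply: le_esum => g _.
by case: ifP => // _; rewrite lee_fin Phi_ge0.
Qed.

Lemma HPhi_delta_le (S : set Rd) (delta : R) :
  (forall g, 2 * d%:R * rho g < delta) ->
  (forall x, S x -> exists g i, (i < N g)%N /\ cball (ctr g i) (rho g) x) ->
  (HPhi_delta alpha Phi S delta <= \sum_(0 <= g <oo) (Phi (t g))%:E)%E.
Proof.
move=> rd SH; apply: le_trans cover_value_le; apply: ereal_inf_lbound.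
exists c, r; split => //.
- by move=> j; exact: rho0.
- move=> j; rewrite diam_j lte_fin; have /andP[_ h] := tauP (blk N j).1.
  exact: le_lt_trans h (rd _).
- move=> x /SH[g [i [iN xi]]]; exists (blk_off N g + i)%N => //.
  by rewrite /c /r blk_offK.
Qed.

End HPhi_groups.

Section HPhi_zero.
Context {R : realType} {d : nat}.
Notation Rd := (d.-tuple R).

(** As each point is covered by groups of arbitrarily large index, any initial segment of groups may
    be dropped. What remains has small diameters and costs a tail of a convergent series. *)
Lemma HPhi_eq0 (alpha : R) (Phi : R -> R) (t rho : nat -> R) (N : nat -> nat)
    (ctr : nat -> nat -> Rd) (S : set Rd) :
  (0 < d)%N -> 0 < alpha -> regular Phi -> (forall g, (0 < N g)%N) ->
  (forall g, 0 < rho g) -> (forall g, 4 * d%:R * rho g.+1 <= rho g) ->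
  (forall g, (N g)%:R * powR (2 * d%:R * rho g) alpha <= t g) ->
  (forall J, \sum_(g < J) Phi (t g) <= 1) ->
  (forall x g0, S x -> exists g i,
     [/\ (g0 <= g)%N, (i < N g)%N & cball (ctr g i) (rho g) x]) ->
  HPhi alpha Phi S = 0%E.
Proof.
move=> d0 a0 Pr N0 rho0 rhoS Nt tsum SH.
have Pge0 x : 0 <= x -> 0 <= Phi x by have [_ _ H _ _] := Pr; exact: H.
have t0 g : 0 <= t g by apply: le_trans (Nt g); rewrite mulr_ge0 ?powR_ge0.
have dR : 1 <= d%:R :> R by rewrite ler1n.
have delta0 (delta : R) : 0 < delta -> HPhi_delta alpha Phi S delta = 0%E.
  move=> del0; apply/eqP; rewrite eq_le; apply/andP; split; last first.
    apply: le_ereal_inf_tmp => _ [c [r [_ _ _ ->]]].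
    apply: esum_ge0 => k _; set m := esum _ _.
    have : (0 <= m)%E by apply: esum_ge0 => j _; exact: poweR_ge0.
    case: m => [x| |]//=; first by rewrite !lee_fin; exact: Pge0.
    move=> _; apply: le_ereal_sup_tmp; exists (Phi 0)%:E; last by rewrite lee_fin Pge0.
    by exists 0; rewrite /= ?lexx.
  have rho_geo g : rho g <= rho 0%N / 2 ^+ g.
    elim: g => [|g IH]; first by rewrite expr0 divr1.
    rewrite exprS invfM mulrCA -ler_pdivrMl ?invr_gt0// invrK.
    by apply: le_trans IH; have := rhoS g; have := rho0 g.+1; nra.
  have [g1 Hg1] : exists g1, forall g, (g1 <= g)%N -> 2 * d%:R * rho g < delta.
    pose g1 := Num.bound (2 * d%:R * rho 0%N / delta).
    have B0 : 0 <= 2 * d%:R * rho 0%N / delta.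
      by rewrite divr_ge0 ?mulr_ge0 ?(ltW (rho0 _)) ?(ltW del0).
    exists g1 => g gg.
    have h1 : 2 * d%:R * rho 0%N / delta < 2 ^+ g.
      apply: lt_le_trans (archi_boundP B0) _; rewrite -natrX ler_nat.
      by rewrite (leq_trans gg)// ltnW// ltn_expl.
    move: h1; rewrite ltr_pdivrMr// (mulrC (2 ^+ g)) -ltr_pdivrMr ?exprn_gt0// => h1.
    by apply: le_lt_trans h1; rewrite -[leRHS]mulrA ler_pM2l ?rho_geo// mulr_gt0//; lra.
  have fin : (\sum_(0 <= g <oo) (Phi (t g))%:E < +oo)%E.
    apply: le_lt_trans (nneseries_le_ub _ tsum) _; last by rewrite ltry.
    by move=> g; exact: Pge0.
  have tail := nneseries_tail_cvg fin (fun g _ => (_ : (0 <= (Phi (t g))%:E)%E)).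
  apply: (@cvge_ge _ _ _ _ _ _ _ _ (tail _)); last first.
    by move=> g; rewrite lee_fin Pge0.
  near=> g0.
  have gg0 : (g1 <= g0)%N by near: g0; exact: nbhs_infty_ge.
  rewrite -(nneseries_addn (f := fun g => (Phi (t g))%:E)); last first.
    by move=> g; rewrite lee_fin Pge0.
  under eq_eseriesr do rewrite addnC.
  have := @HPhi_delta_le R d alpha Phi (fun g => t (g0 + g)%N) (fun g => rho (g0 + g)%N)
    (fun g => N (g0 + g)%N) (fun g => ctr (g0 + g)%N) d0 a0 Pr _ _ _ _ S delta _ _.
  move=> /(_ _ _ _ _ _ _)/le_trans; apply.
  - by move=> g; exact: N0.
  - by move=> g; exact: rho0.
  - by move=> g; rewrite addnS; exact: rhoS.
  - by move=> g; exact: Nt.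
  - by move=> g; apply: Hg1; rewrite (leq_trans gg0)// leq_addr.
  - move=> x /(SH x g0)[g [i [gg iN xi]]].
    by exists (g - g0)%N, i; rewrite subnKC.
  by [].
rewrite /HPhi; apply: lim_near_cst => //.
by near=> delta; apply: delta0; near: delta; exact: nbhs_right_gt.
Unshelve. all: by end_near. Qed.

End HPhi_zero.

(** * The limit measure *)

Lemma integrable_bounded (R : realType) dd (T : measurableType dd)
    (Q : probability T R) (f : T -> R) (M : R) : measurable_fun [set: T] f ->
  (forall u, `|f u| <= M) -> Q.-integrable setT (EFin \o f).
Proof.
move=> mf fM; apply: measurable_bounded_integrable => //.
  by apply: le_lt_trans (probability_le1 Q measurableT) _; rewrite ltry.
exists M; split; first exact: num_real.
by move=> N MN u _ /=; rewrite (le_trans (fM u))// ltW.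
Qed.

Section unit_probability.
Context {R : realType}.

Definition unit_prob : set (measurableTypeR R) -> \bar R :=
  mrestr (@lebesgue_measure R) (measurable_itv `[0, 1[%R).

HB.instance Definition _ := Measure.copy unit_prob
  (mrestr (@lebesgue_measure R) (measurable_itv `[0, 1[%R)).

Let unit_probT : unit_prob setT = 1%E.
Proof.
by rewrite /unit_prob /mrestr setTI lebesgue_measure_itv/= lte_fin ltr01 oppr0 adde0.
Qed.

HB.instance Definition _ := Measure_isProbability.Build _ _ R unit_prob unit_probT.

(* Makes [idx] total: points outside [[0, 1[] form a null set. *)
Definition clamp (u : R) : R := if 0 <= u < 1 then u else 0.

Lemma clamp_itv u : 0 <= clamp u < 1.
Proof. by rewrite /clamp; case: ifP => // _; rewrite lexx ltr01. Qed.

Definition idx (K : nat) (u : R) : nat := Num.trunc (K%:R * clamp u).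

Lemma idxP K u : (idx K u)%:R <= K%:R * clamp u < (idx K u).+1%:R.
Proof.
by apply: truncn_itv; rewrite mulr_ge0//; have /andP[] := clamp_itv u.
Qed.

Lemma idx_lt K u : (0 < K)%N -> (idx K u < K)%N.
Proof.
move=> K0; rewrite -(ltr_nat R); have /andP[h _] := idxP K u.
apply: (le_lt_trans h); have /andP[_ c1] := clamp_itv u.
by rewrite -[ltRHS]mulr1 ltr_pM2l// ltr0n.
Qed.

(** Intervals have their parents under the same division as cubes, so the cubes assigned to a point
    [u] are nested. *)
Lemma idxM K B u : (0 < B)%N -> (idx (K * B) u %/ B)%N = idx K u.
Proof.
move=> B0; have BR : 0 < B%:R :> R by rewrite ltr0n.
apply/esym/truncn_def; have /andP[h1 h2] := idxP (K * B) u.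
set i := idx (K * B) u in h1 h2 *; apply/andP; split.
  rewrite -(ler_pM2r BR) -natrM mulrAC -natrM (le_trans _ h1)// ler_nat.
  exact: leq_trunc_div.
rewrite -(ltr_pM2r BR) -natrM mulrAC -natrM (lt_le_trans h2)// ler_nat.
by rewrite ltn_ceil.
Qed.

Lemma idx_preimage K i : (i < K)%N ->
  [set u | idx K u = i] `&` `[0, 1[ = `[i%:R / K%:R, i.+1%:R / K%:R[%classic.
Proof.
move=> iK; have KR : 0 < K%:R :> R by rewrite ltr0n (leq_ltn_trans _ iK).
apply/seteqP; split => u /=; rewrite !in_itv/= ler_pdivrMr// ltr_pdivlMr//.
  by move=> [<- u01]; have := idxP K u; rewrite /clamp u01 mulrC.
move=> h; have u01 : 0 <= u < 1.
  have /andP[h1 h2] := h; apply/andP; split.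
    by rewrite -(pmulr_lge0 _ KR) (le_trans _ h1).
  rewrite -(ltr_pM2r KR) mul1r (lt_le_trans h2)// ler_nat//.
by split => //; apply: truncn_def; rewrite /clamp u01 mulrC.
Qed.

Lemma measurable_idx K i : measurable [set u | idx K u = i].
Proof.
case: K => [|K].
  have [->|i0] := eqVneq i 0%N.
    rewrite (_ : [set u | _] = setT)//; apply/seteqP; split => // u _ /=.
    by apply: truncn_def; rewrite mul0r lexx ltr01.
  rewrite (_ : [set u | _] = set0)//; apply/seteqP; split => // u /= E.
  by move: i0; rewrite -E /idx mul0r truncn0 eqxx.
have [iK|iK] := ltnP i K.+1; last first.
  rewrite (_ : [set u | _] = set0)//; apply/seteqP; split => // u /= E.
  by have := idx_lt u (ltn0Sn K); rewrite E ltnNge iK.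
have -> : [set u | idx K.+1 u = i] = ([set u | idx K.+1 u = i] `&` `[0, 1[) `|`
    (if i == 0%N then ~` `[0, 1[ else set0).
  apply/seteqP; split => u /=.
    move=> E; have [u01|u01] := pselect (u \in `[0, 1[%R); [by left|right].
    rewrite -E ifT//= /idx /clamp; move: u01; rewrite in_itv/= => /negP/negbTE ->.
    by rewrite mulr0 truncn0.
  case=> [[]//|]; case: eqP => // ->; rewrite /= in_itv/= => /negP/negbTE h.
  by rewrite /idx /clamp h mulr0 truncn0.
rewrite idx_preimage//; apply: measurableU; first exact: measurable_itv.
by case: ifP => // _; apply: measurableC; exact: measurable_itv.
Qed.

Lemma unit_prob_idx K i : (i < K)%N -> unit_prob [set u | idx K u = i] = (K%:R^-1)%:E.
Proof.
move=> iK; rewrite /unit_prob /mrestr idx_preimage// lebesgue_measure_itv/= lte_fin.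
have KR : 0 < K%:R :> R by rewrite ltr0n (leq_ltn_trans _ iK).
rewrite ltr_pM2r ?invr_gt0// ltr_nat ltnSn -EFinB -mulrBl -natr1 addrAC subrr add0r.
by rewrite mul1r.
Qed.

Lemma idx_sum (f : nat -> R) K u : (0 < K)%N ->
  f (idx K u) = \sum_(i < K) f i * \1_[set v | idx K v = i] u.
Proof.
move=> K0; rewrite (bigD1 (Ordinal (idx_lt u K0)))//= big1 ?addr0.
  by rewrite indicE mem_set// mulr1.
move=> i; rewrite -val_eqE/= => /eqP iu; rewrite indicE memNset ?mulr0//=.
by move=> E; apply: iu; rewrite E.
Qed.

Lemma measurable_idx_fun (f : nat -> R) K : (0 < K)%N ->
  measurable_fun [set: R] (f \o idx K).
Proof.
move=> K0; rewrite (_ : _ \o _ = fun u => \sum_(i < K) f i * \1_[set v | idx K v = i] u).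
  apply: measurable_sum => i; apply: measurable_funM => //.
  by apply: measurable_indic; exact: measurable_idx.
by apply/funext => u /=; exact: idx_sum.
Qed.

Lemma unit_integrable (f : R -> R) (M : R) : measurable_fun [set: R] f ->
  (forall u, `|f u| <= M) -> unit_prob.-integrable setT (EFin \o f).
Proof. exact: (@integrable_bounded _ _ _ unit_prob). Qed.

Lemma Rintegral_idx (f : nat -> R) K : (0 < K)%N ->
  \int[unit_prob]_u f (idx K u) = K%:R^-1 * \sum_(i < K) f i.
Proof.
move=> K0; rewrite /Rintegral.
under eq_integral do rewrite (idx_sum f _ K0) -sumEFin.
have mI i : measurable_fun [set: R] (\1_[set v | idx K v = i] : R -> R).
  by apply: measurable_indic; exact: measurable_idx.
rewrite integral_sum//=; last first.
  move=> i; apply: (@unit_integrable _ (`|f i|)).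
    by apply: measurable_funM.
  move=> u; rewrite normrM ler_piMr// indicE; case: (_ \in _); rewrite ?normr1 ?normr0//.
rewrite (eq_bigr (fun i : 'I_K => (f i * K%:R^-1)%:E)).
  by rewrite sumEFin /= -mulr_suml mulrC.
move=> i _; under eq_integral do rewrite EFinM.
have iI : unit_prob.-integrable setT (EFin \o (\1_[set v | idx K v = i] : R -> R)).
  apply: (@unit_integrable _ (1)) => // u.
  by rewrite indicE; case: (_ \in _); rewrite ?normr1 ?normr0.
rewrite integralZl// integral_indic; [|by []|exact: measurable_idx].
rewrite setIT EFinM; congr (_ * _)%E; exact: unit_prob_idx.
Qed.

End unit_probability.

Section nested.
Context {R : realType} {d : nat}.
Notation Rd := (d.-tuple R).
Variables (K B : nat -> nat) (r : nat -> R) (x : nat -> nat -> Rd).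
Hypothesis K0 : forall j, (0 < K j)%N.
Hypothesis B0 : forall j, (0 < B j)%N.
Hypothesis KS : forall j, K j.+1 = (K j * B j)%N.
Hypothesis r0 : forall j, 0 < r j.
Hypothesis rS : forall j, r j.+1 <= r j / 2.
Hypothesis nest : forall j i a,
  `|tnth (x j.+1 i) a - tnth (x j (i %/ B j)%N) a| + r j.+1 / 2 <= r j / 2.

Definition cubes : set Rd := [set y | forall j, exists2 i, (i < K j)%N &
  forall a, `|tnth y a - tnth (x j i) a| <= r j / 2].

Let P : probability (measurableTypeR R) R := unit_prob.

Let Tj (j : nat) (a : 'I_d) (u : R) : R := tnth (x j (idx (K j) u)) a.

Let Tj_near j a u : `|Tj j.+1 a u - Tj j a u| + r j.+1 / 2 <= r j / 2.
Proof.
have E : (idx (K j.+1) u %/ B j)%N = idx (K j) u by rewrite KS idxM.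
by have := nest j (idx (K j.+1) u) a; rewrite E.
Qed.

Let lo_mono a u : nondecreasing_seq (fun j => Tj j a u - r j / 2).
Proof.
apply/nondecreasing_seqP => j; have := Tj_near j a u.
have := ler_norm (- (Tj j.+1 a u - Tj j a u)); rewrite normrN; lra.
Qed.

Let hi_mono a u : nonincreasing_seq (fun j => Tj j a u + r j / 2).
Proof.
apply/nonincreasing_seqP => j; have := Tj_near j a u.
have := ler_norm (Tj j.+1 a u - Tj j a u); lra.
Qed.

Let lo_hi a u j l : Tj j a u - r j / 2 <= Tj l a u + r l / 2.
Proof.
have [jl|/ltnW lj] := leqP j l.
  by apply: le_trans (lo_mono a u jl) _; have := r0 l; lra.
by apply: le_trans (hi_mono a u lj); have := r0 j; lra.
Qed.

Let lo_cvg a u : cvgn (fun j => Tj j a u - r j / 2).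
Proof.
apply: nondecreasing_is_cvgn => //.
by exists (Tj 0%N a u + r 0%N / 2) => _ [j _ <-]; exact: lo_hi.
Qed.

(* The lower faces of nested cubes increase, which gives convergence; their limit is
   that of the centres. *)
Definition limit_map (u : measurableTypeR R) : Rd := [tuple limn (fun j => Tj j a u - r j / 2) | a < d].

Let T_near j u a : `|tnth (limit_map u) a - Tj j a u| <= r j / 2.
Proof.
rewrite tnth_mktuple ler_distl; apply/andP; split.
  exact: nondecreasing_cvgn_le.
by apply: limr_le => //; apply: nearW => l; exact: lo_hi.
Qed.

Let mT : measurable_fun [set: measurableTypeR R] limit_map.
Proof.
apply/measurable_fun_tnthP => a.
apply: (@measurable_fun_cvg _ _ _ _ (fun j u => Tj j a u - r j / 2)).
  move=> j; apply: measurable_funB => //.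
  exact: (@measurable_idx_fun R (fun i => tnth (x j i) a)).
by move=> u _ /=; rewrite tnth_mktuple; exact: lo_cvg.
Qed.

HB.instance Definition _ := @isMeasurableFun.Build _ _ (measurableTypeR R) Rd limit_map mT.

Definition limit_measure : probability Rd R := distribution P limit_map.

(** A point outside all closed cubes of some step [j] is at positive distance from these finitely
    many cubes, while [limit_map] takes its values in them; a small ball about the point then has
    empty preimage. *)
Lemma msupport_limit_measure : msupport limit_measure `<=` cubes.
Proof.
move=> y ysupp; apply: contrapT => /existsNP[j yj].
have far i : (i < K j)%N -> exists a, r j / 2 < `|tnth y a - tnth (x j i) a|.
  move=> iK; apply: contrapT => /forallNP h; apply: yj; exists i => // a.
  by rewrite leNgt; apply/negP; exact: h.
have [e e0 He] : exists2 e, 0 < e & forall i, (i < K j)%N ->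
    exists a, r j / 2 + e <= `|tnth y a - tnth (x j i) a|.
  elim: (K j) far => [|k IH] far; first by exists 1.
  have [i ik|e e0 He] := IH; first by apply: far; exact: ltnW.
  have [a ha] := far k (ltnSn k).
  exists (Num.min e (`|tnth y a - tnth (x j k) a| - r j / 2)).
    by rewrite lt_min e0 subr_gt0.
  move=> i; rewrite ltnS leq_eqVlt => /predU1P[->|ik].
    by exists a; rewrite -lerBrDl ge_min lexx orbT.
  have [b hb] := He i ik; exists b; apply: le_trans hb.
  by rewrite lerD2l ge_min lexx.
have := ysupp e e0; rewrite /limit_measure /= /distribution /pushforward.
rewrite (_ : _ @^-1` _ = set0) ?measure0 ?ltxx//.
apply/seteqP; split => // u; rewrite /oball/= => uy.
have [a ha] := He _ (idx_lt u (K0 j)).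
have h1 := le_lt_trans (coord_le_edist y (limit_map u) a) uy.
have h2 := T_near j u a.
have := ler_normD (tnth y a - tnth (limit_map u) a) (tnth (limit_map u) a - Tj j a u).
rewrite addrA subrK; move: ha; rewrite -/(Tj j a u); lra.
Qed.

Let wave_lip_y th (y y' xi : Rd) (e : R) : (forall a, `|tnth y a - tnth y' a| <= e) ->
  `|wave th y xi - wave th y' xi| <= 2 * pi * (\sum_a `|tnth xi a|) * e.
Proof.
move=> ye; rewrite (le_trans (cos_lip _ _))// opprD addrACA subrr addr0.
rewrite -mulrBr normrM ger0_norm ?mulr_ge0 ?pi_ge0// -[leRHS]mulrA.
rewrite ler_wpM2l ?mulr_ge0 ?pi_ge0// /dotp -sumrB (le_trans (ler_norm_sum _ _ _))//.
rewrite mulr_suml ler_sum// => a _.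
by rewrite -mulrBl normrM mulrC ler_wpM2l.
Qed.

Let psi_near1 (s : R) (xi : Rd) : 0 <= s ->
  `|psi s xi - 1| <= pi * (\sum_a `|tnth xi a|) * s.
Proof.
move=> s0; have -> : pi * (\sum_a `|tnth xi a|) * s = \sum_a `|pi * s * tnth xi a|.
  rewrite mulrAC mulr_sumr; apply: eq_bigr => a _.
  by rewrite normrM [in RHS]ger0_norm ?mulr_ge0 ?pi_ge0.
apply: (@le_trans _ _ (\sum_a `|sinc (pi * s * tnth xi a) - 1|)); last first.
  by apply: ler_sum => a _; rewrite distrC sinc_near1.
rewrite /psi.
(* The bound by 1 on the partial products is carried along for the induction. *)
suff [] : `|\prod_(a < d) sinc (pi * s * tnth xi a) - 1| <=
    \sum_a `|sinc (pi * s * tnth xi a) - 1| /\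
    `|\prod_(a < d) sinc (pi * s * tnth xi a)| <= 1 by [].
apply: (big_ind2 (fun u v => `|u - 1| <= v /\ `|u| <= 1)).
- by rewrite subrr normr0 normr1.
- move=> u1 v1 u2 v2 [h1 h2] [h3 h4]; split; last by rewrite normrM mulr_ile1.
  have -> : u1 * u2 - 1 = (u1 - 1) * u2 + (u2 - 1) by ring.
  rewrite (le_trans (ler_normD _ _))// lerD// normrM (le_trans _ h1)//.
  by rewrite ler_piMr.
- by move=> a _; rewrite sinc_le1.
Qed.

Let measurable_wave th (xi : Rd) : measurable_fun [set: Rd] (fun y => wave th y xi).
Proof.
apply: (@measurableT_comp _ _ _ _ _ _ (@cos R)).
  by apply: continuous_measurable_fun; exact: continuous_cos.
apply: measurable_funD => //; apply: measurable_funM => //.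
apply: measurable_sum => a; apply: measurable_funM => //.
exact: measurable_tnth.
Qed.

Let Rintegral_limit th xi : \int[limit_measure]_y wave th y xi =
  \int[unit_prob]_u wave th (limit_map u) xi.
Proof.
rewrite /Rintegral; congr fine.
have := @integral_distribution _ _ _ _ _ P limit_map (fun y => (wave th y xi)%:E).
apply; first exact/measurable_EFinP.
apply: (@unit_integrable _ _ (1)) => [|u]; last exact: cos_max.
exact: measurableT_comp (measurable_wave th xi) mT.
Qed.

Let FT_near th xi j : `|\int[limit_measure]_y wave th y xi - FT (K j) (r j) (x j) th xi| <=
  2 * pi * (\sum_a `|tnth xi a|) * r j.
Proof.
set X := \sum_a `|tnth xi a|.
have X0 : 0 <= X by apply: sumr_ge0.
rewrite Rintegral_limit /FT.
have E := Rintegral_idx (fun i => wave th (x j i) xi) (K0 j).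
set S := _ * \sum_(i < K j) _ in E *.
have S1 : `|S| <= 1.
  rewrite /S normrM normfV (ger0_norm (ler0n R (K j))) ler_pdivrMl ?ltr0n// mulr1.
  rewrite (le_trans (ler_norm_sum _ _ _))// -[in leRHS](card_ord (K j)) -sumr_const.
  by apply: ler_sum => i _; exact: cos_max.
have i1 : unit_prob.-integrable setT (EFin \o (fun u : R => wave th (limit_map u) xi)).
  apply: (@unit_integrable _ _ (1)) => [|u]; last exact: cos_max.
  exact: measurableT_comp (measurable_wave th xi) mT.
have i2 : unit_prob.-integrable setT
    (EFin \o (fun u : R => wave th (x j (idx (K j) u)) xi)).
  apply: (@unit_integrable _ _ (1)) => [|u]; last exact: cos_max.
  exact: (measurable_idx_fun (fun i => wave th (x j i) xi) (K0 j)).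
have h1 : `|\int[unit_prob]_u wave th (limit_map u) xi - S| <= 2 * pi * X * (r j / 2).
  rewrite -E -RintegralB//.
  apply: (le_trans (le_normr_Rintegral _ _)) => //.
    exact: (integrableB _ i1 i2).
  have -> : 2 * pi * X * (r j / 2) = \int[unit_prob]_(u in setT) (2 * pi * X * (r j / 2) : R).
    by rewrite Rintegral_cst//= probability_setT mulr1.
  apply: le_Rintegral => //.
  - have := integrable_abse (integrableB measurableT i1 i2).
    by apply: eq_integrable.
  - apply: (@unit_integrable _ _ (`|2 * pi * X * (r j / 2)|)) => //.
  - by move=> u _; apply: wave_lip_y => a; exact: T_near.
have h2 := psi_near1 xi (ltW (r0 j)); rewrite -/X in h2.
have -> : \int[unit_prob]_u wave th (limit_map u) xi - S * psi (r j) xi =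
  (\int[unit_prob]_u wave th (limit_map u) xi - S) - S * (psi (r j) xi - 1) by ring.
rewrite (le_trans (ler_normB _ _))//.
have -> : 2 * pi * X * r j = 2 * pi * X * (r j / 2) + pi * X * r j by field.
rewrite lerD// normrM (le_trans _ h2)// ler_piMl//.
Qed.

(** Passage to the limit: by [FT_near] the error at step [j] is a multiple, depending on [xi], of
    [r j], and [rS] makes [r j] tend to zero. *)
Lemma fourier_abs_le xi (M : R) :
  (forall j, `|FT (K j) (r j) (x j) 0 xi| + `|FT (K j) (r j) (x j) (pi / 2) xi| <= M) ->
  fourier_abs limit_measure xi <= M.
Proof.
move=> HM; set X := \sum_a `|tnth xi a|.
have X0 : 0 <= X by apply: sumr_ge0.
have re : fourier_re limit_measure xi = \int[limit_measure]_y wave 0 y xi.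
  by apply: eq_Rintegral => y _; rewrite /wave addr0.
have im : fourier_im limit_measure xi = \int[limit_measure]_y wave (pi / 2) y xi.
  rewrite /fourier_im -mulN1r -RintegralZl//.
    by apply: eq_Rintegral => y _; rewrite /wave cosDpihalf mulN1r.
  apply: (@integrable_bounded _ _ _ limit_measure _ 1) => [|y]; last exact: sin_max.
  rewrite (_ : (fun _ => _) = (fun y => wave (- (pi / 2)) y xi)); first exact: measurable_wave.
  by apply/funext => y; rewrite /wave -cosBpihalf.
have abs_le : fourier_abs limit_measure xi <=
    `|fourier_re limit_measure xi| + `|fourier_im limit_measure xi|.
  have n0 : 0 <= `|fourier_re limit_measure xi| + `|fourier_im limit_measure xi|.
    by rewrite addr_ge0.
  rewrite /fourier_abs -[leRHS]ger0_norm// -sqrtr_sqr ler_wsqrtr// sqrrD.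
  rewrite !real_normK ?num_real// lerD2r lerDl.
  by rewrite mulrn_wge0// mulr_ge0.
apply: (le_trans abs_le); rewrite re im.
have rgeo j : r j <= r 0%N / 2 ^+ j.
  elim: j => [|j IH]; first by rewrite expr0 divr1.
  by rewrite (le_trans (rS j))// exprSr invfM mulrA ler_pM2r.
apply/ler_addgt0Pr => e e0.
pose j := Num.bound (4 * pi * X * r 0%N / e).
have b0 : 0 <= 4 * pi * X * r 0%N / e.
  by rewrite divr_ge0 ?(ltW e0)// !mulr_ge0 ?pi_ge0// ltW.
have jb : 4 * pi * X * r j <= e.
  have : 4 * pi * X * r 0%N / e <= 2 ^+ j.
    apply: le_trans (ltW (archi_boundP b0)) _; rewrite -natrX ler_nat.
    exact/ltnW/ltn_expl.
  rewrite ler_pdivrMr// (mulrC (2 ^+ j)) -ler_pdivrMr ?exprn_gt0//; apply: le_trans.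
  rewrite -[leRHS]mulrA ler_wpM2l ?rgeo// !mulr_ge0 ?pi_ge0//.
have h1 := FT_near 0 xi j; have h2 := FT_near (pi / 2) xi j; rewrite -/X in h1 h2.
have := HM j.
set A := \int[_]_y _ in h1 *; set B1 := \int[_]_y _ in h2 *.
have := ler_normD (A - FT (K j) (r j) (x j) 0 xi) (FT (K j) (r j) (x j) 0 xi).
have := ler_normD (B1 - FT (K j) (r j) (x j) (pi / 2) xi) (FT (K j) (r j) (x j) (pi / 2) xi).
rewrite !subrK; lra.
Qed.

Lemma compact_cubes : compact (@to_row R d @` cubes).
Proof.
pose box j i a := [set v : 'rV[R]_d | `|v ord0 a - tnth (x j i) a| <= r j / 2].
have -> : @to_row R d @` cubes =
    \bigcap_j \bigcup_(i in `I_(K j)) \bigcap_(a in [set: 'I_d]) box j i a.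
  apply/seteqP; split => v.
    move=> [y yc <-] j _; have [i iK h] := yc j.
    by exists i => // a _; rewrite /box/= mxE.
  move=> h; exists [tuple v ord0 a | a < d].
    move=> j; have [i iK hi] := h j I; exists i => // a.
    by rewrite tnth_mktuple; exact: hi.
  by apply/rowP => a; rewrite mxE tnth_mktuple.
have coordc a : continuous (fun v : 'rV[R]_d => v ord0 a) by exact: coord_continuous.
have boxc j i a : closed (box j i a).
  have -> : box j i a = (fun v : 'rV[R]_d => v ord0 a) @^-1`
      `[tnth (x j i) a - r j / 2, tnth (x j i) a + r j / 2]%classic.
    by apply/seteqP; split => v; rewrite /box/= in_itv/= ler_distl.
  by apply: closed_comp; [move=> v _; exact: coordc|exact: itv_closed].
apply: bounded_closed_compact; last first.
  apply: closed_bigI => j _; apply: closed_bigcup; first exact: finite_II.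
  by move=> i _; apply: closed_bigI => a _; exact: boxc.
pose M := \sum_(i < K 0%N) \sum_a `|tnth (x 0%N i) a| + r 0%N.
exists M; split; first exact: num_real.
move=> N MN v /(_ 0%N I)[i iK vi].
rewrite /= [`|v|]mx_normrE; apply/bigmax_leP; split.
  rewrite (le_trans _ (ltW MN))// addr_ge0 ?(ltW (r0 _))//.
  by apply: sumr_ge0 => *; apply: sumr_ge0.
move=> [z a] _ /=; rewrite (ord1 z) (le_trans _ (ltW MN))//.
have h1 : `|v ord0 a - tnth (x 0%N i) a| <= r 0%N / 2 by exact: vi.
have h2 : `|tnth (x 0%N i) a| <= \sum_(i < K 0%N) \sum_a `|tnth (x 0%N i) a|.
  rewrite (bigD1 (Ordinal iK))//= (bigD1 a)//= -addrA lerDl addr_ge0//.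
    exact: sumr_ge0.
  by apply: sumr_ge0 => *; apply: sumr_ge0.
have := ler_normD (v ord0 a - tnth (x 0%N i) a) (tnth (x 0%N i) a).
by rewrite subrK /M; have := r0 0%N; lra.
Qed.

End nested.

(** * The construction *)

Section construction.
Context {R : realType} {d : nat}.
Notation Rd := (d.-tuple R).

(** The starting measure is uniform on the unit cube. [level_set_le] is applied with one cell and
    one choice, where [fluct] vanishes and the summand [sqrt #|E| = 1] remains; the two phases
    account for the factor 2 in front. *)
Lemma initial_level (m : nat) : (0 < d)%N -> (2 <= m)%N ->
  exists2 C : R, 0 < C & forall (K : nat) (s : R) i, (0 < K)%N -> 0 < s -> (2 <= i <= m)%N ->
  (lebesgue_d [set xi : Rd | (s <= `|FT K 1 (fun=> [tuple 0 | a < d]) 0 xi| +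
     `|FT K 1 (fun=> [tuple 0 | a < d]) (pi / 2) xi|)%R] <= (C * (1 / s) ^+ i)%:E)%E.
Proof.
move=> d0 m2; pose o : Rd := [tuple 0 | a < d].
pose y (i : 'I_1) (g : 'I_1) := o.
have y1 i g a : `|tnth (y i g) a| <= 1 by rewrite tnth_mktuple normr0.
have E1 : (0 < #|[set: 'I_1]%SET|)%N by rewrite cardsT card_ord.
have G1 : (0 < #|'I_1|)%N by rewrite card_ord.
have r01 : 0 < (1 : R) <= 1 by rewrite ltr01 lexx.
have [w Hw] := level_set_le y1 E1 G1 d0 r01 m2.
pose C0 := 8 * 4 ^+ d * (2 ^+ d * (16 * m%:R)) ^+ m : R.
have m0 : 0 < m%:R :> R by rewrite ltr0n (leq_trans _ m2).
have C00 : 0 < C0 by rewrite /C0 !mulr_gt0 ?exprn_gt0// ?mulr_gt0// exprn_gt0.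
exists (C0 * 2 ^+ m) => [|K s i K0 s0 im]; first by rewrite mulr_gt0// exprn_gt0.
have := Hw 2 s i _ s0 im; rewrite ltr0n => /(_ isT) H2.
apply: (le_trans _ (le_trans H2 _)).
  apply: le_lebesgue_d => xi /= sxi.
  have FTle th : `|FT K 1 (fun=> o) th xi| <= `|psi 1 xi|.
    rewrite /FT normrM ler_piMl// normrM normfV (ger0_norm (ler0n R K)).
    rewrite ler_pdivrMl ?ltr0n// mulr1 (le_trans (ler_norm_sum _ _ _))//.
    rewrite -[in leRHS](card_ord K) -sumr_const.
    by apply: ler_sum => k _; exact: cos_max.
  apply: (le_trans sxi); rewrite (le_trans (lerD (FTle _) (FTle _)))//.
  rewrite -mulr2n -[leLHS]mulr_natl ler_peMr ?mulr_ge0//.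
  by rewrite cardsT card_ord sqrtr1 lerDl addr_ge0.
rewrite lee_fin -/C0 cardsT card_ord sqrtr1 mulr1 expr1n divr1.
rewrite -[2 / s]/(2 * s^-1) exprMn mulrA mul1r ler_wpM2r ?exprn_ge0 ?invr_ge0 ?(ltW s0)//.
by rewrite ler_pM2l// ler_weXn2l ?ler1n//; have /andP[] := im.
Qed.

(** Since all cubes of a step have equally many children, the ancestor several steps back is found
    by one division, by the product [M] of the numbers of children. *)
Lemma nested_ancestor (K B : nat -> nat) (r : nat -> R) (x : nat -> nat -> Rd) :
  (forall j, (0 < K j)%N) -> (forall j, (0 < B j)%N) ->
  (forall j, K j.+1 = (K j * B j)%N) ->
  (forall j i a, `|tnth (x j.+1 i) a - tnth (x j (i %/ B j)%N) a| + r j.+1 / 2 <= r j / 2) ->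
  forall l j, exists M, [/\ (0 < M)%N, K (l + j)%N = (K l * M)%N &
    forall (y : Rd) i, (forall a, `|tnth y a - tnth (x (l + j)%N i) a| <= r (l + j)%N / 2) ->
     forall a, `|tnth y a - tnth (x l (i %/ M)%N) a| <= r l / 2].
Proof.
move=> K0 B0 KS nest l; elim=> [|j [M [M0 KM IH]]].
  exists 1%N; rewrite addn0 muln1; split => // y i h a.
  by rewrite divn1.
exists (B (l + j) * M)%N; split.
- by rewrite muln_gt0 B0.
- by rewrite addnS KS KM -mulnA (mulnC M).
- move=> y i h a; rewrite divnMA; apply: IH => b.
  move: (h b); rewrite addnS => hb; have := nest (l + j)%N i b.
  have := ler_normD (tnth y b - tnth (x (l + j).+1 i) b)
    (tnth (x (l + j).+1 i) b - tnth (x (l + j)%N (i %/ B (l + j)%N)%N) b).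
  by rewrite addrA subrK; lra.
Qed.

(** A state consists of the number, the side and the centres of the cubes. One fraction has [K %/ n]
    cubes, and [Ng] is a length with a list of centres that exhausts the children of the active
    cubes. *)
Definition refines (C p : R) (m : nat) (n k : nat) (t : R) (st st' : nat * R * (nat -> Rd)) (B : nat) :=
  let: (K, r, x) := st in let: (K', r', x') := st' in
  [/\ [/\ (0 < B)%N, K' = (K * B)%N, 0 < r' & 4 * d%:R * r' <= r],
      (forall i a, `|tnth (x' i) a - tnth (x (i %/ B)%N) a| + r' / 2 <= r / 2),
      (exists Ng : nat * (nat -> Rd), [/\ (0 < Ng.1)%N,
         Ng.1%:R * powR (2 * d%:R ^+ 2 * r') (2 * d%:R / p) <= t &
         forall i, (i < K')%N -> (i %/ B %/ (K %/ n) = k)%N ->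
           exists2 s, (s < Ng.1)%N & x' i = Ng.2 s]) &
      forall (s : R) (i : nat), 0 < s -> (2 <= i <= m)%N ->
      (lebesgue_d [set xi | (s <= `|FT K' r' x' 0 xi - FT K r x 0 xi| +
         `|FT K' r' x' (pi / 2) xi - FT K r x (pi / 2) xi|)%R] <=
       (C * r' ^- d * (n%:R^-1 * powR t (- 2^-1) * powR r' (d%:R / p) / s) ^+ i)%:E)%E].

Lemma refinement_sequence (p : R) (m : nat) (n k : nat -> nat) (t : nat -> R) (c : nat -> R) :
  (0 < d)%N -> 2 < p -> (2 <= m)%N ->
  (forall j, (k j < n j)%N) -> (forall j, 0 < t j) -> (forall j, 0 < c j) ->
  exists (C : R) (K B : nat -> nat) (r : nat -> R) (x : nat -> nat -> Rd),
  [/\ 0 < C, r 0%N = 1 /\ x 0%N = (fun=> [tuple 0 | a < d]),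
      (forall j, [/\ (0 < K j)%N, (n j %| K j)%N & 0 < r j]),
      (forall j, 2 * (c j.+1 * powR (r j.+1) (d%:R / p)) <= c j * powR (r j) (d%:R / p)) &
      forall j, refines C p m (n j) (k j) (t j) (K j, r j, x j) (K j.+1, r j.+1, x j.+1) (B j)].
Proof.
move=> d0 p2 m2 kn t0 c0.
have [C C0 Hstep] := @refinement_step R d p m d0 p2 m2.
have n0 j : (0 < n j)%N by exact: leq_ltn_trans (kn j).
have dR : 1 <= d%:R :> R by rewrite ler1n.
have dp0 : 0 < d%:R / p by rewrite divr_gt0//; lra.
pose St := (nat * R * (nat -> Rd))%type.
pose good (j : nat) (st : St) := [/\ (0 < st.1.1)%N, (n j %| st.1.1)%N, 0 < st.1.2 <= 1 &
  forall i a, `|tnth (st.2 i) a| + st.1.2 / 2 <= 1].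
pose nxt (j : nat) (st : St) (stB : St * nat) :=
  [/\ good j.+1 stB.1,
      2 * (c j.+1 * powR stB.1.1.2 (d%:R / p)) <= c j * powR st.1.2 (d%:R / p) &
      refines C p m (n j) (k j) (t j) st stB.1 stB.2].
have ex (a : nat * St) : exists stB, good a.1 a.2 -> nxt a.1 a.2 stB.
  case: a => j [[K r] x] /=.
  have [gd|ngd] := pselect (good j (K, r, x)); last by exists ((K, r, x), 0%N) => /ngd.
  have [/= K0 nK /andP[r0 r1] xr] := gd.
  pose v := powR (c j * powR r (d%:R / p) / (2 * c j.+1)) (d%:R / p)^-1.
  have u0 : 0 < c j * powR r (d%:R / p) / (2 * c j.+1).
    by rewrite divr_gt0 ?mulr_gt0 ?powR_gt0.
  have v0 : 0 < v by rewrite powR_gt0.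
  (* The first bound gives the ratio of radii needed for the coverings, the second makes the
     amplitudes [c j * r j ^ (d / p)] at least halve. *)
  pose rho := Num.min (r / (4 * d%:R)) v.
  have rho0 : 0 < rho by rewrite lt_min v0 divr_gt0//; lra.
  have e0 : (0 < K %/ n j)%N by rewrite divn_gt0 ?n0// dvdn_leq.
  have KE : K = (n j * (K %/ n j))%N by rewrite mulnC divnK.
  have r01 : 0 < r <= 1 by rewrite r0.
  have [B [r' [x' [[B0 nB r'0 r'rho r'r] nest grp lev]]]] :=
    Hstep K r x (n j) (K %/ n j)%N (k j) (n j.+1) (t j) rho r01 xr KE e0 (kn j) (n0 j.+1) (t0 j) rho0.
  exists (((K * B)%N, r', x'), B) => _; split.
  - split => /=.
    + by rewrite muln_gt0 K0.
    + by rewrite dvdn_mull.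
    + by rewrite r'0 (le_trans r'r).
    + move=> i a; have := nest i a; have := xr (i %/ B)%N a.
      have := ler_normD (tnth (x' i) a - tnth (x (i %/ B)%N) a) (tnth (x (i %/ B)%N) a).
      by rewrite subrK; lra.
  - rewrite /= mulrA mulrC -ler_pdivlMr ?mulr_gt0//.
    have -> : c j * powR r (d%:R / p) / (2 * c j.+1) = powR v (d%:R / p).
      by rewrite /v -powRrM mulVf ?gt_eqF// powRr1// ltW.
    rewrite ge0_ler_powR ?nnegrE ?(ltW dp0) ?(ltW r'0) ?(ltW v0)//.
    by rewrite (le_trans r'rho)// ge_min lexx orbT.
  - split => //.
      split => //; rewrite mulrC -ler_pdivlMr; last lra.
      by rewrite (le_trans r'rho)// ge_min lexx.
    by have [N [g [? ? ?]]] := grp; exists (N, g).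
have [F HF] := choice ex.
(* The unit cube is listed [n 0] times, so that the first step can split its mass into [n 0]
   fractions. *)
pose st0 : St := (n 0%N, 1, fun=> [tuple 0 | a < d]).
pose st := fix st (j : nat) : St := if j is j'.+1 then (F (j', st j')).1 else st0.
have gst j : good j (st j).
  elim: j => [|j IH]; last by have [] := HF (j, st j) IH.
  split => //=; first by rewrite ltr01 lexx.
  by move=> i a; rewrite tnth_mktuple normr0; lra.
have nst j := HF (j, st j) (gst j).
exists C, (fun j => (st j).1.1), (fun j => (F (j, st j)).2), (fun j => (st j).1.2), (fun j => (st j).2).
split => //.
- by move=> j; have [? ? /andP[? _] _] := gst j.
- by move=> j; have [_ h _] := nst j.
- move=> j; have [_ _ h] := nst j; move: h => /=.
  by case: (st j) => [[? ?] ?]; case: (F _) => [[[? ?] ?] ?].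
Qed.

End construction.

Theorem theorem7p1 (R : realType) (d : nat) (p q : R) (Phi : R -> R) :
  (0 < d)%N -> 2 < p -> 1 < q ->
  regular Phi ->
  (fun t => Phi t / powR t ((q / (q - 1)) / 2)) x @[x --> 0^'+] --> 0 ->
  exists (S : set (d.-tuple R)) (mu : probability (d.-tuple R) R),
    [/\ compact (@to_row R d @` S),
        msupport mu `<=` S,
        in_Lorentz p q (fourier_abs mu) &
        HPhi (2 * d%:R / p) Phi S = 0%E].
Proof.
move=> d0 p2 q1 Preg Plim.
have P0 x : 0 <= x -> 0 <= Phi x by have [_ _ H _ _] := Preg; exact: H.
have dR : 1 <= d%:R :> R by rewrite ler1n.
have p0 : 0 < p by lra.
have [n [k [t [kn t0 tq tPhi blocks]]]] := stage_sequence q1 P0 Plim.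
have n0 j : (0 < n j)%N by exact: leq_ltn_trans (kn j).
(* The index is shifted by one: [c 0] belongs to the initial cube and [c i.+1] to the [i]-th
   refinement. *)
pose c j : R := if j is i.+1 then (n i)%:R^-1 * powR (t i) (- 2^-1) else 1.
have c0 j : 0 < c j.
  by case: j => [|j] //=; rewrite mulr_gt0 ?powR_gt0// invr_gt0 ltr0n.
pose m := (Num.bound (2 * p + 2)).+2.
have pm : 2 * p + 2 <= m%:R.
  have h : 0 <= 2 * p + 2 by lra.
  by rewrite (le_trans (ltW (archi_boundP h)))// ler_nat /m ltnW.
have m2 : (2 <= m)%N by [].
have [C [K [B [r [x [C0 [r0E x0E] Kr lac ref]]]]]] :=
  refinement_sequence d0 p2 m2 kn t0 c0.
have K0 j : (0 < K j)%N by have [] := Kr j.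
have nK j : (n j %| K j)%N by have [] := Kr j.
have r0 j : 0 < r j by have [] := Kr j.
have B0 j : (0 < B j)%N by have [[]] := ref j.
have KS j : K j.+1 = (K j * B j)%N by have [[]] := ref j.
have rS4 j : 4 * d%:R * r j.+1 <= r j by have [[]] := ref j.
have nest j i a : `|tnth (x j.+1 i) a - tnth (x j (i %/ B j)%N) a| + r j.+1 / 2 <= r j / 2.
  by have [_ + _ _] := ref j; exact.
have rS j : r j.+1 <= r j / 2 by have := rS4 j; have := r0 j.+1; nra.
have grp j : exists Ng : nat * (nat -> d.-tuple R), [/\ (0 < Ng.1)%N,
    Ng.1%:R * powR (2 * d%:R ^+ 2 * r j.+1) (2 * d%:R / p) <= t j &
    forall i, (i < K j.+1)%N -> (i %/ B j %/ (K j %/ n j) = k j)%N ->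
      exists2 s, (s < Ng.1)%N & x j.+1 i = Ng.2 s] by have [_ _ + _] := ref j.
have [Ng HNg] := choice grp.
exists (cubes K r x), (limit_measure K0 B0 KS r0 nest); split.
- exact: compact_cubes.
- exact: msupport_limit_measure.
- have [C' C'0 lev0] := @initial_level R d m d0 m2.
  pose F j th xi := FT (K j) (r j) (x j) th xi.
  pose H j xi := if j is i.+1 then `|F i.+1 0 xi - F i 0 xi| + `|F i.+1 (pi / 2) xi - F i (pi / 2) xi|
    else `|F 0%N 0 xi| + `|F 0%N (pi / 2) xi|.
  pose A j := c j * powR (r j) (d%:R / p).
  have A0 j : 0 < A j by rewrite mulr_gt0 ?powR_gt0.
  have cA j : powR (c j / A j) p = r j ^- d.
    rewrite /A invfM mulrA divff ?gt_eqF// mul1r -powRN -powRrM mulNr divfK ?gt_eqF//.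
    by rewrite powRN powR_mulrn// ltW.
  (* [C] serves the refinements and [C'] the initial cube. The bound 2 is [c 0 ^ q = 1] plus the
     bound 1 from [tq]. *)
  apply: (@in_Lorentz_sum R d p q (C + C') 2 m _ H A c) => //.
  + by rewrite addr_ge0// ltW.
  + by move=> j; exact: ltW.
  + case=> [|J]; first by rewrite big_ord0.
    rewrite big_ord_recl/= powR1 (_ : 2 = 1 + 1)// lerD2l.
    exact: tq.
  + move=> j s i s0 im; rewrite cA; case: j => [|j].
      rewrite /H /F r0E x0E; apply: le_trans (lev0 _ s i (K0 0%N) s0 im) _.
      rewrite lee_fin /A r0E expr1n invr1 mulr1 powR1 mulr1.
      by rewrite ler_wpM2r ?exprn_ge0 ?divr_ge0 ?(ltW s0)// lerDr ltW.
    have [_ _ _ lev] := ref j; apply: le_trans (lev s i s0 im) _.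
    rewrite lee_fin -mulrA -[leRHS]mulrA ler_wpM2r ?lerDl ?(ltW C'0)//.
    rewrite mulr_ge0 ?invr_ge0 ?exprn_ge0 ?(ltW (r0 _))//.
    exact: divr_ge0 (ltW (A0 j.+1)) (ltW s0).
  + move=> xi b T Hb bT.
    have -> : `|fourier_abs (limit_measure K0 B0 KS r0 nest) xi| =
        fourier_abs (limit_measure K0 B0 KS r0 nest) xi.
      by rewrite ger0_norm// sqrtr_ge0.
    apply: fourier_abs_le => // j; apply: le_trans (bT j.+1).
    elim: j => [|j IH]; first by rewrite big_ord1; exact: Hb 0%N.
    rewrite big_ord_recr/=; have := Hb j.+1; rewrite /H -/(F _ _ _).
    have := ler_normD (F j.+1 0 xi - F j 0 xi) (F j 0 xi).
    have := ler_normD (F j.+1 (pi / 2) xi - F j (pi / 2) xi) (F j (pi / 2) xi).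
    by rewrite !subrK; move: IH; rewrite -!/(F _ _ _); lra.
- apply: (@HPhi_eq0 R d _ Phi t (fun g => d%:R * r g.+1) (fun g => (Ng g).1)
    (fun g => (Ng g).2)) => //.
  + by rewrite divr_gt0// mulr_gt0//; lra.
  + by move=> g; have [] := HNg g.
  + by move=> g; rewrite mulr_gt0//; lra.
  + move=> g; rewrite mulrCA ler_pM2l; last lra.
    exact: rS4.
  + move=> g; have [_ + _] := HNg g.
    by rewrite (_ : 2 * d%:R * (d%:R * r g.+1) = 2 * d%:R ^+ 2 * r g.+1)//; ring.
  (* At the end [J] of a late block, [y] lies in some cube [i], whose fraction is [kk]. Its
     ancestors in the block lie in the same fraction, so the ancestor at step [g = j1 + kk] is
     active, and [y] lies in one of the chosen subcubes at index [g.+1]. *)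
  move=> y g0 Sy; have [j1 gj1 Hj1] := blocks g0.
  pose J := (j1 + n j1)%N.
  have [i iK yi] := Sy J.
  have [M0 [M00 KM0 _]] := nested_ancestor K0 B0 KS nest j1 (n j1).
  have nKJ : (n j1 %| K J)%N by rewrite /J KM0 dvdn_mulr.
  pose kk := (i %/ (K J %/ n j1))%N.
  have kkn : (kk < n j1)%N.
    rewrite ltn_divLR; first by rewrite mulnC divnK.
    by rewrite divn_gt0// dvdn_leq.
  have [ng kg] := Hj1 kk kkn.
  pose g := (j1 + kk)%N; rewrite -/g in ng kg.
  have gJ : (g.+1 + (n j1 - kk.+1) = J)%N by rewrite /g /J -addnS -addnA subnKC.
  have [M [M1 KM HM]] := nested_ancestor K0 B0 KS nest g.+1 (n j1 - kk.+1)%N.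
  rewrite gJ in KM HM; have {HM} yg := HM y i yi.
  have iM : (i %/ M < K g.+1)%N by rewrite ltn_divLR// -KM.
  have [_ _ /(_ (i %/ M)%N iM)] := HNg g.
  case; last first.
    move=> s sN xs; exists g, s; split => //; first by rewrite (leq_trans gj1)// leq_addr.
    rewrite -xs; apply: cube_sub_cball => a; rewrite distrC.
    by rewrite (le_trans (yg a))//; have := r0 g.+1; lra.
  (* Dividing by [M], by [B g] and by the size of a fraction at step [g] is dividing by the size of
     a fraction at step [J], because [n] is constant on the block. *)
  rewrite kg ng -!divnMA /kk; congr (_ %/ _)%N.
  have nKg : (n j1 %| K g)%N by rewrite -ng.
  by rewrite KM KS -mulnA -divn_mulAC// mulnA mulnC (mulnC M).
Qed.
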